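(* Let $\mathbb{F}=\mathbb{F}_q$ be the field with $q$ elements and let $\xi$ be a primitive element of $\mathbb{F}$. Let $C$ be a $k$-dimensional Cauchy code over $\mathbb{F}$ with scaling map $f:L\to\mathbb{F}^*$, where $L\subseteq\overline{\mathbb{F}}$, and assume that $|L|=q-1$ and $2\le k\le q-3$. Then $C$ is a left group code if and only if one of the following conditions holds for some (equivalently, for all) $T\in\mathrm{PGL}_2(\mathbb{F})$ with $T(L)=\mathbb{F}^*$: (1) there is an integer $m$ such that $(\theta_{T,L}^{k-1}\cdot f)\circ T_L^{-1}$ is equivalent to the map $f_m:\mathbb{F}^*\to\mathbb{F}^*$ given by $f_m(z)=z^m$ for every $z\in\mathbb{F}^*$; (2) $q$ is odd and there are integers $m$ and $m'$ such that $4m+2(k-1)\equiv 2m'+k-1\equiv 0 \pmod{q-1}$ and $(\theta_{T,L}^{k-1}\cdot f)\circ T_L^{-1}$ is equivalent to the map $f_{m,m'}:\mathbb{F}^*\to\mathbb{F}^*$ given by $$f_{m,m'}(\xi^{2t+r})=\xi^{2tm+rm'}\quad\text{for every } t\in\mathbb{Z}\text{ and } r\in\{0,1\}.$$ Moreover, if $G$ is a group of order $q-1$, then $C$ is a left $G$-code if and only if either $G$ is cyclic and condition (1) holds, or $G$ is a dihedral group and condition (2) holds.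
   Context: Let $\overline{\mathbb{F}}=\mathbb{F}\cup\{\infty\}$ be the projective line over $\mathbb{F}$, where $x\in\mathbb{F}$ is identified with $[x,1]$ and $\infty$ with $[1,0]$. Let $\varphi:\overline{\mathbb{F}}\to\mathbb{F}^2$, $\varphi(x)=(x,1)$ for $x\in\mathbb{F}$ and $\varphi(\infty)=(1,0)$. For a homogeneous polynomial $P\in\mathbb{F}[X,Y]$ and $z\in\overline{\mathbb{F}}$ put $P(z)=P(\varphi(z))$. Cauchy codes: given $1\le k<n$, $\alpha=(\alpha_1,\dots,\alpha_n)\in\overline{\mathbb{F}}^n$ without repeated entries, with set of entries $L_\alpha$ (the location set), and a map $f:L_\alpha\to\mathbb{F}^*$, the $k$-dimensional Cauchy code with location vector $\alpha$ and scaling map $f$ is $$\mathcal{C}_k(\alpha,f)=\{(f(\alpha_1)P(\alpha_1),\dots,f(\alpha_n)P(\alpha_n)):P\in\mathbb{F}[X,Y]\text{ homogeneous of degree }k-1\}\subseteq\mathbb{F}^n.$$ ''A $k$-dimensional Cauchy code with scaling map $f:L\to\mathbb{F}^*$'' means $\mathcal{C}_k(\alpha,f)$ for some $\alpha$ with $L_\alpha=L$ (so its length is $|L|$). $\mathrm{GL}_2(\mathbb{F})$ acts on $\overline{\mathbb{F}}$ by $\begin{pmatrix}a&b\\c&d\end{pmatrix}[x,y]=[ax+by,cx+dy]$, and $\mathrm{PGL}_2(\mathbb{F})$ is identified with the induced group of homographies of $\overline{\mathbb{F}}$. For $T\in\mathrm{GL}_2(\mathbb{F})$, $\theta_T:\overline{\mathbb{F}}\to\mathbb{F}^*$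 is defined by: $\theta_T(z)$ is the second coordinate of the vector $T(\varphi(z))\in\mathbb{F}^2$ if that is non-zero, and the first coordinate of $T(\varphi(z))$ otherwise. $T_L$ and $\theta_{T,L}$ denote the restrictions to $L$ of $T:\overline{\mathbb{F}}\to\overline{\mathbb{F}}$ and of $\theta_T$; here $T_L$ is regarded as a bijection $L\to T(L)$. For $T\in\mathrm{PGL}_2(\mathbb{F})$, $\theta_T$ is computed using any representative in $\mathrm{GL}_2(\mathbb{F})$; since $\theta_{\lambda T}=\lambda\theta_T$, this does not affect equivalence of maps. Products and powers of $\mathbb{F}^*$-valued maps are pointwise. Two maps $f,g$ from the same set to $\mathbb{F}^*$ are equivalent if $g=\lambda f$ for some $\lambda\in\mathbb{F}^*$. Let $E=\{e_1,\dots,e_n\}$ be the standard basis of $\mathbb{F}^n$. For a group $G$ of order $n$, a linear code $C\subseteq\mathbb{F}^n$ is a left $G$-code if there is a bijection $\phi:E\to G$ whose linear extension $\phi:\mathbb{F}^n\to\mathbb{F}G$ to the group algebra maps $C$ onto a left ideal of $\mathbb{F}G$; it is a left group code if it is a left $G$-code for some group $G$. The dihedral group of order $2m$ is $\langle a,b\mid a^m=b^2=1,\ bab^{-1}=a^{-1}\rangle$ (for $m=2$ this is the Klein four-group). *)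

(* Defs.v *)
From HB Require Import structures.
From mathcomp Require Import all_boot all_order all_algebra.
From mathcomp Require Import all_fingroup all_solvable all_field all_character.
From mathcomp Require Import mpoly.

Set Implicit Arguments.
Unset Strict Implicit.
Unset Printing Implicit Defensive.

Import GRing.Theory.
Local Open Scope ring_scope.

Section CauchyCodes.
Variable F : finFieldType.

(* [Some x] is the point [x, 1] and [None] is the point oo = [1, 0]. *)
Definition pline : finType := option F.

(* The map varphi : pline -> F^2, with values written as columns. *)
Definition pvec (z : pline) : 'cV[F]_2 :=
  \col_(i < 2) (if z is Some x then [:: x; 1] else [:: 1; 0])`_i.

(* The point [v 0, v 1] of the projective line, for v != 0. *)
Definition ppoint (v : 'cV[F]_2) : pline :=
  if v 1 0 == 0 then None else Some (v 0 0 / v 1 0).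

Definition peval (P : {mpoly F[2]}) (z : pline) : F :=
  P.@[fun i => pvec z i 0].

(* Scaling maps L -> F^* are represented by total functions; only their values
   on L matter, and these are required to be non-zero where needed. *)
Definition cauchy_code (n k : nat) (alpha : 'I_n -> pline) (f : pline -> F)
    (v : 'rV[F]_n) : Prop :=
  exists2 P : {mpoly F[2]}, P \is (k.-1).-homog &
    v = \row_i (f (alpha i) * peval P (alpha i)).

Definition is_cauchy_code (n k : nat) (L : {set pline}) (f : pline -> F)
    (C : {vspace 'rV[F]_n}) : Prop :=
  (1 <= k < n)%N /\
  exists alpha : 'I_n -> pline,
    [/\ injective alpha, [set alpha i | i : 'I_n] = L &
        forall v, v \in C <-> cauchy_code k alpha f v].

Definition homography (T : {'GL_2[F]}) (z : pline) : pline :=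
  ppoint (GLval T *m pvec z).

Definition theta (T : {'GL_2[F]}) (z : pline) : F :=
  let v := GLval T *m pvec z in if v 1 0 != 0 then v 1 0 else v 0 0.

Definition pstar : {set pline} := [set Some x | x : F & x != 0].

Definition sends_to_pstar (L : {set pline}) (T : {'GL_2[F]}) : Prop :=
  [set homography T z | z in L] = pstar.

(* The map (theta_T^(k-1) . f) o T^(-1), read on F^* as a subset of F. *)
Definition transport (k : nat) (f : pline -> F) (T : {'GL_2[F]}) (x : F) : F :=
  let z := homography T^-1%g (Some x) in theta T z ^+ k.-1 * f z.

(* Equivalence of maps F^* -> F^*, up to a non-zero scalar. *)
Definition equiv_maps (f g : F -> F) : Prop :=
  exists2 lambda : F, lambda != 0 & forall x, x != 0 -> g x = lambda * f x.

Definition cond1 (k : nat) (f : pline -> F) (T : {'GL_2[F]}) : Prop :=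
  exists m : int, equiv_maps (transport k f T) (fun x => x ^ m).

(* g is the map f_{m,m'}; when #|F| is odd the equation determines g on F^*. *)
Definition is_fmm (xi : F) (m m' : int) (g : F -> F) : Prop :=
  forall (t : int) (r : nat), (r < 2)%N ->
    g (xi ^ (2 * t + r%:Z)) = xi ^ (2 * t * m + r%:Z * m').

Definition cond2 (xi : F) (k : nat) (f : pline -> F) (T : {'GL_2[F]}) : Prop :=
  odd #|F| /\
  exists m m' : int,
    [/\ (4 * m + 2 * (k.-1)%:Z = 0 %[mod (#|F|.-1)%:Z])%Z,
        (2 * m' + (k.-1)%:Z = 0 %[mod (#|F|.-1)%:Z])%Z &
        exists2 g : F -> F, is_fmm xi m m' g & equiv_maps (transport k f T) g].

End CauchyCodes.

Section GroupCodes.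
Variables (F : fieldType) (n : nat).

(* [group_ring F G] is the group algebra FG, embedded in the matrix algebra by
   the regular representation, under which x in G is [regular_repr F G x]. *)
Definition is_left_ideal (gT : finGroupType) (G : {group gT})
    (I : 'A[F]_#|G|) : Prop :=
  (I <= group_ring F G)%MS /\ left_mx_ideal (group_ring F G) I.

(* Linear extension F^n -> FG of the map sending the i-th basis vector to
   phi i. *)
Definition lin_ext (gT : finGroupType) (G : {group gT}) (phi : 'I_n -> gT)
    (v : 'rV[F]_n) : 'M[F]_#|G| :=
  \sum_i v 0 i *: regular_repr F G (phi i).

Definition left_G_code (gT : finGroupType) (G : {group gT})
    (C : {vspace 'rV[F]_n}) : Prop :=
  #|G| = n /\
  exists phi : 'I_n -> gT,
    [/\ injective phi, [set phi i | i : 'I_n] = G :> {set gT} &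
        exists2 I : 'A[F]_#|G|, is_left_ideal I &
          forall A, (A \in I)%MS <-> exists2 v, v \in C & A = lin_ext G phi v].

Definition left_group_code (C : {vspace 'rV[F]_n}) : Prop :=
  exists (gT : finGroupType) (G : {group gT}), left_G_code G C.

End GroupCodes.

Definition is_dihedral (gT : finGroupType) (G : {group gT}) : Prop :=
  exists2 m : nat, (0 < m)%N &
    (G \isog Grp (a : b : a ^+ m, b ^+ 2, b * a * b^-1 = a^-1))%g.

(* Main.v *)
Require Import Defs.
From HB Require Import structures.
From mathcomp Require Import all_boot all_order all_algebra.
From mathcomp Require Import all_fingroup all_solvable all_field all_character.
From mathcomp Require Import mpoly.
From mathcomp Require Import ring zify.

(** A homography T with T(L) = F^* turns the code into the set of vectors
    (g y * p y)_(y in F^* ), deg p < k, where g is the transported scaling map.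
    It is a left G-code iff F^* can be labelled by G so that all left
    translations preserve this set.  A permutation s of F^* preserving it maps
    minimum weight words to minimum weight words, hence preserves the
    cross-ratios of points of F^*; so s is the restriction of a homography
    stabilizing {0, oo}, that is, y |-> a y or y |-> a / y.  These preserve the
    code iff g (a y) = c g y, resp. g (a / y) = c y^(k-1) g y, for a constant c.
    If all translations are scalings, then G embeds in F^* and is cyclic, and g
    is a power map up to a scalar.  Otherwise the scalings among them are those
    by the squares of F^* (an inversion y |-> a / y has no fixed point, so a is
    not a square), G is dihedral, generated by y |-> xi^2 y and y |-> xi / y, and
    the two conditions on g amount to the form f_{m,m'} with its congruences. *)

Set Implicit Arguments.
Unset Strict Implicit.
Unset Printing Implicit Defensive.

Import GRing.Theory.
Local Open Scope ring_scope.

(** * Left group codes *)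

Section LeftGroupCodes.
Variables (F : fieldType) (n : nat) (gT : finGroupType) (G : {group gT}).
Implicit Types (C : {vspace 'rV[F]_n}) (v : 'rV[F]_n).

Variable phi : 'I_n -> gT.
Hypothesis phiG : forall i, phi i \in G.

Lemma lin_ext_is_linear : linear (@lin_ext F n gT G phi).
Proof.
move=> a u v; rewrite /lin_ext scaler_sumr -big_split /=.
by apply: eq_bigr => i _; rewrite !mxE scalerDl scalerA.
Qed.

HB.instance Definition _ := GRing.isLinear.Build F 'rV[F]_n 'M[F]_#|G| _
  (@lin_ext F n gT G phi) lin_ext_is_linear.

Lemma lin_ext_in_group_ring v : (lin_ext G phi v \in group_ring F G)%MS.
Proof.
rewrite /lin_ext linear_sum summx_sub //= => i _.
by rewrite linearZ scalemx_sub //= envelop_mx_id.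
Qed.

(** The elements of [G] are linearly independent in the group ring: the projection
    [gring_proj (phi j)] reads off the coefficient at [phi j]. *)
Lemma lin_ext_inj : injective phi -> injective (@lin_ext F n gT G phi).
Proof.
move=> injphi u v eq_uv; apply/rowP => j.
have proj (w : 'rV[F]_n) : gring_proj (phi j) (lin_ext G phi w) = (w 0 j)%:M.
  rewrite /lin_ext linear_sum (bigD1 j) //= linearZ /= gring_projE // eqxx.
  rewrite big1 ?addr0 => [|i ne_ij]; first by rewrite scalemx1.
  by rewrite linearZ /= gring_projE // (inj_eq injphi) eq_sym (negPf ne_ij) scaler0.
by have := proj u; rewrite eq_uv proj => /matrixP/(_ 0 0); rewrite !mxE eqxx.
Qed.

(** Left multiplication by [h] moves the coefficient at [h^-1 * x] to [x], whence the inverse on the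
    right. *)
Lemma mul_lin_ext (phi' : gT -> 'I_n) (h : gT) v :
  cancel phi phi' -> {in G, cancel phi' phi} -> h \in G ->
  regular_repr F G h *m lin_ext G phi v =
    lin_ext G phi (\row_i v 0 (phi' (h^-1 * phi i)%g)).
Proof.
move=> phiK phi'K Gh; pose s i := phi' (h * phi i)%g.
have sK : cancel s (fun i => phi' (h^-1 * phi i)%g).
  by move=> i; rewrite /s phi'K ?groupM // mulKg phiK.
rewrite /lin_ext mulmx_sumr [RHS](reindex_inj (can_inj sK)) /=.
apply: eq_bigr => i _; rewrite mxE sK phi'K ?groupM //.
by rewrite -scalemxAr repr_mxM.
Qed.

End LeftGroupCodes.

(** Since [G] spans the group ring, a subspace of it is a left ideal as soon as left multiplication
    by each group element preserves it. Ideals thus give way to coordinate permutations, and [phi']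
    makes the inverse bijection explicit. *)
Lemma left_G_codeP (F : fieldType) n gT (G : {group gT})
    (C : {vspace 'rV[F]_n}) :
  left_G_code G C <-> #|G| = n /\
  exists phi : 'I_n -> gT, exists phi' : gT -> 'I_n,
    [/\ forall i, phi i \in G, cancel phi phi', {in G, cancel phi' phi} &
        forall h v, h \in G -> v \in C ->
          \row_i v 0 (phi' (h * phi i)%g) \in C].
Proof.
split=> [[oG [phi [injphi imphi [I [sI idI] memI]]]]|].
  split=> //; have phiG i : phi i \in G by rewrite -imphi imset_f.
  have n_gt0 : (0 < n)%N by rewrite -oG cardG_gt0.
  (* The default index is reached only outside [G]. *)
  pose phi' x := odflt (Ordinal n_gt0) [pick i | phi i == x].
  have phiK : cancel phi phi'.
    rewrite /phi' => i; case: pickP => [j /eqP/injphi //|/(_ i)].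
    by rewrite eqxx.
  have phi'K : {in G, cancel phi' phi}.
    by move=> x; rewrite -imphi => /imsetP[i _ ->]; rewrite phiK.
  exists phi, phi'; split=> // h v Gh Cv.
  have Iv : (lin_ext G phi v \in I)%MS by apply/memI; exists v.
  have : (regular_repr F G h^-1%g *m lin_ext G phi v \in I)%MS.
    by move/mulsmx_subP: idI; apply=> //; rewrite envelop_mx_id ?groupV.
  rewrite (mul_lin_ext phiG _ phiK phi'K) ?groupV // invgK.
  by case/memI=> w Cw /(lin_ext_inj phiG injphi) ->.
case=> oG [phi [phi' [phiG phiK phi'K Cact]]]; split=> //.
exists phi; split; first exact: can_inj phiK.
  apply/setP=> x; apply/imsetP/idP=> [[i _ ->] //|Gx].
  by exists (phi' x); rewrite ?phi'K.
(* The rows are the flattened images of a basis of the code, so the row space of [M] is the image of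
   the code. *)
pose M := \matrix_(i < \dim C) mxvec (lin_ext G phi (vbasis C)`_i).
have memM A : (A \in <<M>>)%MS <-> exists2 v, v \in C & A = lin_ext G phi v.
  rewrite genmxE; split=> [/submxP[D defA]|[v Cv ->]].
    exists (\sum_i D 0 i *: (vbasis C)`_i).
      by apply: memv_suml => i _; rewrite memvZ // vbasis_mem ?mem_nth ?size_tuple.
    rewrite linear_sum -[LHS]mxvecK defA mulmx_sum_row linear_sum.
    by apply: eq_bigr => i _; rewrite !linearZ /= rowK mxvecK.
  rewrite (coord_vbasis Cv) (linear_sum (lin_ext G phi)) linear_sum.
  apply: summx_sub => i _; rewrite !linearZ scalemx_sub //=.
  by have := row_sub i M; rewrite rowK.
exists <<M>>%MS => //; split.
  apply/memmx_subP=> A /memM[v _ ->].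
  exact: lin_ext_in_group_ring.
apply/mulsmx_subP=> A B /envelop_mxP[a ->] /memM[v Cv ->].
rewrite mulmx_suml linear_sum summx_sub //= => h Gh.
rewrite -scalemxAl linearZ scalemx_sub //=; apply/memM.
rewrite (mul_lin_ext _ _ phiK phi'K) //.
by exists (\row_i v 0 (phi' (h^-1 * phi i)%g)); rewrite ?Cact ?groupV.
Qed.

(** * Reduction to the location set F^* *)

Section Homographies.
Variable F : finFieldType.
Implicit Types (z : pline F) (v : 'cV[F]_2) (T : {'GL_2[F]}).

Lemma pvec_neq0 z : pvec z != 0.
Proof.
apply/eqP=> /colP zE; case: z zE => [x /(_ 1)|/(_ 0)]; rewrite !mxE /=;
  by move/eqP; rewrite oner_eq0.
Qed.

Lemma ppointZ (c : F) z : c != 0 -> ppoint (c *: pvec z) = z.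
Proof.
move=> c0; case: z => [x|]; rewrite /ppoint !mxE /= ?mulr0 ?eqxx // mulr1.
by rewrite (negPf c0) mulrAC divff // mul1r.
Qed.

(** The scalar is spelled out as in [theta], so that taking [GLval T *m pvec z] for [v] yields
    [GL_pvec] and [theta_neq0]. *)
Lemma pvec_ppoint v : v != 0 ->
  v = (if v 1 0 != 0 then v 1 0 else v 0 0) *: pvec (ppoint v) /\
  (if v 1 0 != 0 then v 1 0 else v 0 0) != 0.
Proof.
move=> v0; have ordE (j : 'I_2) : j = 0 \/ j = 1.
  by case: j => [[|[|]]] // ?; [left | right]; apply: val_inj.
rewrite /ppoint; case: eqVneq => [v10|v1] /=; last first.
  split=> //; apply/colP => j; rewrite !mxE.
  by case: (ordE j) => ->; rewrite /= ?mulr1 // mulrC divfK.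
have v00 : v 0 0 != 0.
  apply: contraNneq v0 => v00; apply/eqP/colP => j; rewrite !mxE.
  by case: (ordE j) => ->.
split=> //; apply/colP => j; rewrite !mxE.
by case: (ordE j) => ->; rewrite /= ?mulr1 ?mulr0.
Qed.

Lemma GL_pvec_neq0 T z : GLval T *m pvec z != 0.
Proof.
apply: contra_neq (pvec_neq0 z) => Tz0.
have uT : GLval T \in unitmx := valP T.
by rewrite -(mulKmx uT (pvec z)) Tz0 mulmx0.
Qed.

Lemma GL_pvec T z : GLval T *m pvec z = theta T z *: pvec (homography T z).
Proof. by have [] := pvec_ppoint (GL_pvec_neq0 T z). Qed.

Lemma theta_neq0 T z : theta T z != 0.
Proof. by have [] := pvec_ppoint (GL_pvec_neq0 T z). Qed.

Lemma homographyK T : cancel (homography T) (homography T^-1%g).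
Proof.
move=> z; have uT : GLval T \in unitmx := valP T.
have th0 := theta_neq0 T z.
rewrite {1}/homography -[pvec (homography T z)](scalerK th0) -GL_pvec -scalemxAr.
have -> : GLval T^-1%g = invmx (GLval T) by rewrite GL_VxE.
by rewrite mulKmx // ppointZ // invr_eq0.
Qed.

End Homographies.

Section Dehomogenization.
Variable F : fieldType.

Lemma meval_homogZ n d (P : {mpoly F[n]}) (c : F) (v : 'I_n -> F) :
  P \is d.-homog -> P.@[fun i => c * v i] = c ^+ d * P.@[v].
Proof.
move=> hP; rewrite !mevalE mulr_sumr big_seq [RHS]big_seq.
apply: eq_bigr => m mP; rewrite -(dhomog_mf hP mP) mulrCA; congr (_ * _).
rewrite /= mdegE -prodrXr -big_split /=.
by apply: eq_bigr => i _; rewrite exprMn.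
Qed.

Lemma dhomog_comp n m d e (P : {mpoly F[n]}) (lq : n.-tuple {mpoly F[m]}) :
  P \is d.-homog -> (forall i, tnth lq i \is e.-homog) ->
  P \mPo lq \is (e * d)%N.-homog.
Proof.
move=> hP hlq; rewrite comp_mpolyEX big_seq rpred_sum // => u uP.
rewrite rpredZ // comp_mpolyX -(dhomog_mf hP uP) /= mdegE big_distrr /=.
elim/big_rec2: _ => [|i a b _ hab]; first exact: dhomog1.
by apply: dhomogM => //; apply: dhomogMn.
Qed.

(** The rows of [M] are substituted as linear forms, which keeps the degree; this is the pullback of
    a form along a matrix. *)
Lemma dhomog_mulmx m n d (M : 'M[F]_(n, m)) (P : {mpoly F[n]}) :
  P \is d.-homog -> exists2 Q : {mpoly F[m]}, Q \is d.-homog &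
    forall v : 'cV[F]_m, Q.@[fun i => v i 0] = P.@[fun i => (M *m v) i 0].
Proof.
move=> hP; pose lq := [tuple \sum_j M i j *: 'X_j | i < n] : n.-tuple {mpoly F[m]}.
exists (P \mPo lq) => [|v].
  rewrite -[d]mul1n; apply: dhomog_comp => // i; rewrite tnth_mktuple.
  by apply: rpred_sum => j _; rewrite rpredZ // dhomogX; apply/eqP/mdeg1.
rewrite comp_mpoly_meval; apply: meval_eq => i.
rewrite tnth_mktuple raddf_sum mxE; apply: eq_bigr => j _.
by rewrite /= mevalZ mevalXU.
Qed.

End Dehomogenization.

Section BinaryForms.
Variable F : finFieldType.

Lemma dehomogenize d (P : {mpoly F[2]}) : P \is d.-homog ->
  exists2 p : {poly F}, (size p <= d.+1)%N & forall x, peval P (Some x) = p.[x].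
Proof.
move=> hP; exists (\sum_(m <- msupp P) P@_m *: 'X^(m 0)) => [|x].
  apply: leq_trans (size_sum _ _ _) _; apply/bigmax_leqP_seq => m mP _.
  rewrite (leq_trans (size_scale_leq _ _)) //.
  rewrite size_polyXn ltnS -(dhomog_mf hP mP) /= mdegE.
  by rewrite big_ord_recl leq_addr.
rewrite /peval mevalE horner_sum; apply: eq_bigr => m _.
rewrite !hornerE !big_ord_recl big_ord0 !mxE /= expr1n !mulr1.
by [].
Qed.

Lemma homogenize d (p : {poly F}) : (size p <= d.+1)%N ->
  exists2 P : {mpoly F[2]}, P \is d.-homog & forall x, peval P (Some x) = p.[x].
Proof.
move=> sp; exists (\sum_(i < d.+1) p`_i *: ('X_0 ^+ i * 'X_1 ^+ (d - i))).
  apply: rpred_sum => i _; apply: rpredZ.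
  have X1 j e : 'X_j ^+ e \is [in F[2], e.-homog].
    by rewrite -[X in X.-homog]mul1n dhomogMn // dhomogX; apply/eqP/mdeg1.
  have := dhomogM (X1 0 i) (X1 1 (d - i)%N).
  by rewrite subnKC // -ltnS.
move=> x; rewrite /peval raddf_sum (horner_coef_wide _ sp).
apply: eq_bigr => i _; rewrite /= mevalZ mevalM !rmorphXn /= !mevalXU !mxE /=.
by rewrite expr1n mulr1.
Qed.

End BinaryForms.

Section StandardForm.
Variable F : finFieldType.
Implicit Types (L : {set pline F}) (T : {'GL_2[F]}) (f : pline F -> F).

Lemma card_pstar : #|pstar F| = #|F|.-1.
Proof.
have -> : pstar F = Some @: [set~ 0].
  by apply/setP=> z; apply/imsetP/imsetP => -[x x0 ->]; exists x => //;
    rewrite !inE in x0 *.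
by rewrite card_imset ?cardsC1 // => x y [].
Qed.

Lemma pstarP z : reflect (exists2 x : F, x != 0 & z = Some x) (z \in pstar F).
Proof.
apply: (iffP imsetP) => -[x x0 ->]; exists x => //;
  by move: x0; rewrite !inE.
Qed.

(** The determinant with columns [pvec z] and [pvec a], used as a linear form in [pvec z] whose only
    zero on the projective line is [a]. *)
Definition pbracket (a z : pline F) : F :=
  pvec a 1 0 * pvec z 0 0 - pvec a 0 0 * pvec z 1 0.

Lemma pbracket_eq0 a z : (pbracket a z == 0) = (a == z).
Proof.
rewrite /pbracket; case: a z => [a|] [z|]; rewrite !mxE /=.
- by rewrite mul1r mulr1 subr_eq0 eq_sym.
- by rewrite mulr1 mulr0 subr0 oner_eq0.
- by rewrite mul0r mulr1 sub0r oppr_eq0 oner_eq0.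
- by rewrite mul0r mulr0 subrr !eqxx.
Qed.

(** The projective line has [#|F| + 1] points, so [L] misses exactly two, [a] and [b]. The matrix
    whose rows are the brackets with [a] and [b] sends [a] to 0 and [b] to infinity, hence [L] into
    F^*; counting makes the inclusion an equality. *)
Lemma exists_sends_to_pstar L : #|L| = #|F|.-1 ->
  exists T, sends_to_pstar L T.
Proof.
move=> oL; have /cards2P[a [b [neq_ab defLc]]] : #|~: L| == 2%N.
  rewrite cardsCs setCK card_option oL.
  case: #|F| (finNzRing_gt1 F : (1 < #|F|)%N) => [|q] // q_gt0.
  by rewrite subSn ?leqnSn // subSnn.
pose M : 'M[F]_2 := \matrix_(i, j)
  [:: [:: pvec a 1 0; - pvec a 0 0]`_j; [:: pvec b 1 0; - pvec b 0 0]`_j]`_i.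
have uM : M \is a GRing.unit.
  have detM : \det M = - pbracket a b.
    rewrite (expand_det_row _ 0) !big_ord_recl big_ord0 /cofactor !det_mx11.
    by rewrite /pbracket !mxE /=; ring.
  by rewrite unitmxE unitfE detM oppr_eq0 pbracket_eq0.
exists (FinRing.unit _ uM); have MzE z : M *m pvec z =
    \col_i [:: pbracket a z; pbracket b z]`_i.
  apply/colP => i; rewrite !mxE !big_ord_recl big_ord0 addr0 !mxE /=.
  by case: i => [[|[|]]] //= _; rewrite /pbracket !mxE mulNr.
apply/eqP; rewrite eqEcard card_imset; last exact: can_inj (homographyK _).
rewrite card_pstar oL leqnn andbT; apply/subsetP => _ /imsetP[z Lz ->].
have : z \notin ~: L by rewrite inE negbK.
rewrite defLc !inE negb_or eq_sym [z == b]eq_sym -!pbracket_eq0 => /andP[az bz].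
apply/pstarP; exists (pbracket a z / pbracket b z).
  by rewrite mulf_neq0 ?invr_eq0.
by rewrite /homography /ppoint MzE !mxE /= (negPf bz).
Qed.

(* The code of all (g y * p y)_(y in F^* ), deg p < k, where beta enumerates F^*. *)
Definition scaled_poly_code n k (g : F -> F) (beta : 'I_n -> F)
    (v : 'rV[F]_n) : Prop :=
  exists2 p : {poly F}, (size p <= k)%N & v = \row_i (g (beta i) * p.[beta i]).

(** Replacing [GLval T *m pvec z] by the chosen representative of the image point costs a form of
    degree [k.-1] the factor [theta T z ^+ k.-1], which is the one built into [transport]. On F^*
    forms of this degree are the same as polynomials of size at most [k]. *)
Lemma cauchy_codeP n k L f T (C : {vspace 'rV[F]_n}) :
  {in L, forall z, f z != 0} -> sends_to_pstar L T -> is_cauchy_code k L f C ->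
  [/\ n = #|F|.-1, (0 < k)%N, forall y, y != 0 -> transport k f T y != 0 &
  exists beta : 'I_n -> F,
    [/\ injective beta, forall i, beta i != 0 &
        forall v, v \in C <-> scaled_poly_code k (transport k f T) beta v]].
Proof.
move=> f0 TL [/andP[k_gt0 _] [alpha [injalpha defL memC]]].
have alphaL i : alpha i \in L by rewrite -defL imset_f.
have injT := can_inj (homographyK T).
have ThE z : z \in L -> exists2 x, x != 0 & homography T z = Some x.
  by move=> Lz; apply/pstarP; rewrite -TL imset_f.
pose beta i := odflt 0 (homography T (alpha i)).
have betaE i : homography T (alpha i) = Some (beta i).
  by rewrite /beta; have [x _ ->] := ThE _ (alphaL i).
have beta0 i : beta i != 0.
  by have [x x0] := ThE _ (alphaL i); rewrite betaE => -[->].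
have trE i : transport k f T (beta i) = theta T (alpha i) ^+ k.-1 * f (alpha i).
  by rewrite /transport -betaE homographyK.
split=> //.
- by rewrite -card_pstar -TL card_imset // -defL card_imset // card_ord.
- move=> y y0; have : Some y \in pstar F by apply/pstarP; exists y.
  rewrite -TL => /imsetP[z Lz defy]; rewrite /transport defy homographyK.
  by rewrite mulf_neq0 ?f0 // expf_neq0 ?theta_neq0.
have evT (P Q : {mpoly F[2]}) z x : P \is (k.-1).-homog ->
    (forall v : 'cV[F]_2, Q.@[fun i => v i 0] = P.@[fun i => (GLval T *m v) i 0]) ->
    homography T z = Some x -> peval Q z = theta T z ^+ k.-1 * peval P (Some x).
  move=> hP QP zx; rewrite /peval QP GL_pvec zx -(meval_homogZ _ _ hP).
  by apply: meval_eq => i; rewrite mxE.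
exists beta; split=> // [i j ij|v].
  by apply: injalpha; apply: injT; rewrite !betaE ij.
split=> [/memC[P hP ->]|[p sp ->]].
  have [Q hQ QE] := dhomog_mulmx (GLval T^-1%g) hP.
  have PE (w : 'cV[F]_2) :
      P.@[fun i => w i 0] = Q.@[fun i => (GLval T *m w) i 0].
    by rewrite QE mulmxA GL_VxE mulVmx ?mul1mx //; apply: (valP T).
  have [p sp pE] := dehomogenize hQ; exists p; first by rewrite -(prednK k_gt0).
  apply/rowP => i; rewrite !mxE trE (evT Q P _ _ hQ PE (betaE i)) pE.
  by rewrite -mulrA mulrCA.
rewrite -(prednK k_gt0) in sp; have [P hP PE] := homogenize sp.
have [Q hQ QE] := dhomog_mulmx (GLval T) hP.
apply/memC; exists Q => //; apply/rowP => i; rewrite !mxE trE.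
by rewrite (evT P Q _ _ hP QE (betaE i)) PE -mulrA mulrCA.
Qed.

End StandardForm.

(** * Coordinate permutations preserving the code *)

Lemma uniq_avoiding (F : finFieldType) (A : seq F) m : (size A + m <= #|F|)%N ->
  exists K : seq F, [/\ uniq K, size K = m & {in K, forall x, x \notin A}].
Proof.
move=> le_m; pose B := [seq x <- enum F | x \notin A].
have sB : (m <= size B)%N.
  have := count_predC (mem A) (enum F); rewrite -cardE -(size_filter (predC _)) -/B.
  have : (count (mem A) (enum F) <= size A)%N.
    rewrite -size_filter uniq_leq_size => [//||x]; last first.
      by rewrite mem_filter => /andP[].
    by apply: filter_uniq; apply: enum_uniq.
  rewrite /B /predC /=; move: (count _ _) (size _) le_m => a b.
  by move: #|F|; lia.
exists (take m B); split.
- by apply: take_uniq; apply: filter_uniq; apply: enum_uniq.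
- by rewrite size_takel.
- by move=> x /mem_take; rewrite mem_filter => /andP[].
Qed.

Lemma poly_eq0_on_units (F : finFieldType) (p : {poly F}) : (size p < #|F|)%N ->
  (forall y, y != 0 -> p.[y] = 0) -> p = 0.
Proof.
move=> sp p0; apply/eqP; apply: contraTT sp => nz_p.
rewrite -leqNgt -(prednK (ltnW (finNzRing_gt1 F))).
have := max_poly_roots nz_p (_ : all (root p) (enum [set~ (0 : F)])).
rewrite -cardE cardsC1 => -> //; last exact: enum_uniq.
by apply/allP => y; rewrite mem_enum !inE => /p0/eqP.
Qed.

Section CodeSymmetries.
Variables (F : finFieldType) (k : nat).
Hypotheses (k_ge2 : (2 <= k)%N) (k_le : (k <= #|F| - 3)%N).
Implicit Types (g s r : F -> F) (p : {poly F}).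

(* The values of [s] matter on F^* only, where [s] is meant to be a permutation. *)
Definition code_symmetry g s :=
  forall p, (size p <= k)%N -> exists2 p' : {poly F}, (size p' <= k)%N &
    forall y, y != 0 -> g (s y) * p.[s y] = g y * p'.[y].

Let k_gt0 : (0 < k)%N. Proof. exact: leq_trans k_ge2. Qed.
Let k_lt : (k < #|F|.-1)%N. Proof. by move: k_ge2 k_le; case: #|F| => [|q]; lia. Qed.

(** Applied to 1, the hypothesis gives a polynomial [p1] that agrees with [r]. If [p1] were not
    constant, a suitable power of ['X] would bring the product to degree exactly [k]; it would agree
    on F^* with a polynomial of degree below [k], hence equal it, as [k] is less than the number of
    units. *)
Lemma poly_multiplier_const r :
  (forall p, (size p <= k)%N -> exists2 p' : {poly F}, (size p' <= k)%N &
     forall y, y != 0 -> r y * p.[y] = p'.[y]) ->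
  exists c, forall y, y != 0 -> r y = c.
Proof.
move=> rP; have [|p1 sp1 p1E] := rP 1; first by rewrite size_poly1.
case: (leqP (size p1) 1) => [/size1_polyC p1C | sp1_gt1].
  exists p1`_0 => y y0.
  by rewrite -(hornerC p1`_0 y) -p1C -p1E // hornerC mulr1.
have [|p2 sp2 p2E] := rP 'X^(k.+1 - size p1); first by rewrite size_polyXn; lia.
have p1_neq0 : p1 != 0 by rewrite -size_poly_gt0 ltnW.
have sp3 : size (p1 * 'X^(k.+1 - size p1)) = k.+1.
  by rewrite size_mulXn // subnK // ltnW.
suff eq_p : p1 * 'X^(k.+1 - size p1) = p2.
  by move: sp2; rewrite -eq_p sp3 ltnn.
apply/eqP; rewrite -subr_eq0; apply/eqP; apply: poly_eq0_on_units => [|y y0].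
  rewrite (leq_ltn_trans (size_polyD _ _)) // size_polyN sp3 gtn_max.
  have k1_lt : (k.+1 < #|F|)%N by rewrite -ltn_predRL.
  by rewrite k1_lt (leq_ltn_trans sp2) // ltnW.
by rewrite !hornerE -p1E // -p2E // !hornerE subrr.
Qed.

(** For binary forms of degree [k.-1] this is the substitution of [(a Y, X)] for [(X, Y)]: the
    coefficients are reversed and weighted by powers of [a]. *)
Lemma reverse_poly (a : F) p : (size p <= k)%N ->
  exists2 p' : {poly F}, (size p' <= k)%N &
    forall y, y != 0 -> y ^+ k.-1 * p.[a / y] = p'.[y].
Proof.
move=> sp; exists (\sum_(i < k) (p`_i * a ^+ i) *: 'X^(k.-1 - i)).
  apply: leq_trans (size_sum _ _ _) _; apply/bigmax_leqP_seq => i _ _.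
  by rewrite (leq_trans (size_scale_leq _ _)) // size_polyXn; lia.
move=> y y0; rewrite (horner_coef_wide _ sp) mulr_sumr horner_sum.
apply: eq_bigr => i _; rewrite !hornerE.
have -> : y ^+ k.-1 = y ^+ (k.-1 - i) * y ^+ i.
  by rewrite -exprD subnK // -ltnS prednK.
rewrite expr_div_n; move: (y ^+ (k.-1 - i)) (y ^+ i) (expf_neq0 i y0) => u w w0.
by rewrite /=; field.
Qed.

(** The substitution of [a * y] preserves the polynomials of size at most [k], so the ratio
    [g (a * y) / g y] multiplies this space into itself and [poly_multiplier_const] applies. *)
Lemma scale_symmetryP g a s : a != 0 -> (forall y, y != 0 -> g y != 0) ->
  (forall y, y != 0 -> s y = a * y) ->
  code_symmetry g s <->
  exists c, forall y, y != 0 -> g (a * y) = c * g y.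
Proof.
move=> a0 g0 sE; have szZ b p : (size (p \Po (b *: 'X)) <= size p)%N.
  case: (eqVneq b 0) => [->|b0]; last by rewrite size_comp_poly2 ?size_scale ?size_polyX.
  rewrite scale0r comp_poly0r; case: (eqVneq p 0) => [->|p0].
    by rewrite coef0 size_poly0.
  by rewrite (leq_trans (size_polyC_leq1 _)) ?size_poly_gt0.
split=> [gs|[c gc] p sp]; last first.
  exists (c *: (p \Po (a *: 'X))) => [|y y0].
    by rewrite (leq_trans (size_scale_leq _ _)) // (leq_trans (szZ _ _)).
  rewrite sE // gc // !hornerE horner_comp !hornerE /=; ring.
have [|c cE] := @poly_multiplier_const (fun y => g (a * y) / g y).
  move=> p sp; have [|p' sp' p'E] := gs (p \Po (a^-1 *: 'X)).
    exact: leq_trans (szZ _ _) sp.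
  exists p' => // y y0; have := p'E y y0.
  rewrite sE // horner_comp hornerZ hornerX mulKf // => h.
  by rewrite mulrAC h mulrAC divff ?mul1r ?g0.
by exists c => y y0; rewrite -(cE y y0) divfK ?g0.
Qed.

Lemma inverse_symmetryP g a s : a != 0 -> (forall y, y != 0 -> g y != 0) ->
  (forall y, y != 0 -> s y = a / y) ->
  code_symmetry g s <->
  exists c, forall y, y != 0 -> g (a / y) = c * (y ^+ k.-1 * g y).
Proof.
move=> a0 g0 sE; split=> [gs|[c gc] p sp]; last first.
  have [p' sp' p'E] := reverse_poly a sp.
  exists (c *: p') => [|y y0]; first exact: leq_trans (size_scale_leq _ _) sp'.
  by rewrite sE // gc // hornerZ -p'E //; ring.
have [|c cE] := @poly_multiplier_const (fun y => g (a / y) / (y ^+ k.-1 * g y)).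
  move=> p sp; have [p1 sp1 p1E] := reverse_poly a sp.
  have [p' sp' p'E] := gs p1 sp1.
  (* Reversing [p1] returns [p] with the factor [(a / y) ^+ k.-1], whose constant part is cancelled
     here. *)
  exists ((a ^- k.-1) *: p') => [|y y0].
    exact: leq_trans (size_scale_leq _ _) sp'.
  have := p'E y y0; rewrite sE // -p1E ?mulf_neq0 ?invr_eq0 //.
  have -> : a / (a / y) = y by field; rewrite y0 a0.
  rewrite hornerZ expr_div_n => h.
  have gy := g0 y y0; have ak := expf_neq0 k.-1 a0; have yk := expf_neq0 k.-1 y0.
  apply: (mulfI gy); rewrite [RHS]mulrCA -h.
  by field; rewrite gy ak yk.
exists c => y y0; rewrite -(cE y y0) divfK // mulf_neq0 ?g0 //.
exact: expf_neq0.
Qed.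

End CodeSymmetries.

(** * Symmetries of the code are scalings or inversions *)

Section SymmetriesAreMonomial.
Variables (F : finFieldType) (k : nat).
Hypotheses (k_ge2 : (2 <= k)%N) (k_le : (k <= #|F| - 3)%N).
Variables (g s : F -> F).
Hypotheses (g0 : forall y, y != 0 -> g y != 0) (s0 : forall y, y != 0 -> s y != 0).
Hypothesis s_inj : forall x y, x != 0 -> y != 0 -> s x = s y -> x = y.
Hypothesis gs : code_symmetry k g s.

Let card_bound : (k.+3 <= #|F|)%N.
Proof. by move: k_ge2 k_le; case: #|F| => [|q]; lia. Qed.

Let k2_succ : k.-2.+2 = k. Proof. by rewrite -[RHS](subnK k_ge2) addn2 subn2. Qed.

Lemma prod_XsubC_neq0 (rs : seq F) y : y \notin rs ->
  \prod_(u <- rs) (y - u) != 0.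
Proof.
move=> nrs; rewrite prodf_seq_neq0; apply/allP => u urs /=.
by rewrite subr_eq0; apply: contraNneq nrs => ->.
Qed.

Lemma notin_map_s (rs : seq F) y :
  {in rs, forall u, u != 0} -> y != 0 -> y \notin rs -> s y \notin map s rs.
Proof.
move=> rs0 y0; apply: contraNN => /mapP[u urs /s_inj -> //].
exact: rs0.
Qed.

(* A codeword of minimum weight is determined up to a scalar by its zeros. *)
Lemma symmetry_min_weight (rs : seq F) : uniq rs -> size rs = k.-1 ->
  {in rs, forall u, u != 0} ->
  exists2 c, c != 0 & forall y, y != 0 ->
    g (s y) * \prod_(u <- rs) (s y - s u) = c * (g y * \prod_(u <- rs) (y - u)).
Proof.
move=> urs srs rs0.
have prodE (A : seq F) x : (\prod_(u <- A) ('X - u%:P)).[x] = \prod_(u <- A) (x - u).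
  by rewrite horner_prod; apply: eq_bigr => u _; rewrite !hornerE.
have [|p sp pE] := gs (p := \prod_(u <- map s rs) ('X - u%:P)).
  by rewrite size_prod_XsubC size_map srs prednK // ltnW.
have {}pE y : y != 0 -> g (s y) * \prod_(u <- rs) (s y - s u) = g y * p.[y].
  by move=> /pE <-; rewrite prodE big_map.
(* One non-zero point off [rs] shows that [p] is not zero; its [k.-1] known roots then fix it up to
   its leading coefficient. *)
have [|K [_ sK Krs]] := @uniq_avoiding F (0 :: rs) 1.
  by apply: leq_trans card_bound; rewrite /= srs addn1 (prednK (ltnW k_ge2)) ltnS !leqW.
case: K sK Krs => [//|y [|//]] _ /(_ y (mem_head _ _)).
rewrite inE negb_or => /andP[y0 y_rs].
have p_neq0 : p != 0.
  apply/eqP => p0; have /eqP := pE y y0.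
  rewrite p0 horner0 mulr0 mulf_eq0 (negPf (g0 (s0 y0))) /=.
  have := prod_XsubC_neq0 (notin_map_s rs0 y0 y_rs).
  by rewrite big_map => /negPf ->.
have rootsp : all (root p) rs.
  apply/allP => u u_rs; have u0 := rs0 _ u_rs.
  have /eqP := pE u u0; rewrite (big_rem u) //= subrr mul0r mulr0 eq_sym.
  by rewrite mulf_eq0 (negPf (g0 u0)).
have size_p : size p = (size rs).+1.
  apply/eqP; rewrite eqn_leq (max_poly_roots p_neq0 rootsp urs) andbT.
  by rewrite srs prednK // ltnW.
have pC := all_roots_prod_XsubC size_p rootsp (_ : uniq_roots rs).
exists (lead_coef p); first by rewrite lead_coef_eq0.
move=> x x0; rewrite pE // {1}pC ?uniq_rootsE // hornerZ prodE.
by rewrite mulrCA.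
Qed.

(** Two minimum weight words whose zeros are [a :: K] and [b :: K] have quotient [(y - a) / (y - b)]
    up to a constant, and so do their images with [s] applied. This is a relation off [K] only, with
    a constant that may depend on [K]; the reference point [e], kept off every [K], fixes the
    constant to [c0]. *)
Lemma symmetry_cross_ratio a b : a != 0 -> b != 0 -> a != b ->
  forall e, e != 0 -> e != a -> e != b ->
  exists2 c, c != 0 & forall y, y != 0 ->
    c * (s y - s a) * (y - b) = (s y - s b) * (y - a).
Proof.
move=> a0 b0 ab e e0 ea eb.
pose c0 := (s e - s b) * (e - a) / ((s e - s a) * (e - b)).
have s_neq x y : x != 0 -> y != 0 -> x != y -> s x - s y != 0.
  by move=> x0 y0; apply: contraNneq => /subr0_eq/s_inj ->.
have d1 := s_neq _ _ e0 a0 ea; have d2 := s_neq _ _ e0 b0 eb.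
have d3 : e - a != 0 by rewrite subr_eq0.
have d4 : e - b != 0 by rewrite subr_eq0.
exists c0 => [|y y0]; first by rewrite !mulf_neq0 ?invr_neq0 ?mulf_neq0.
have c0E c : c * (s e - s a) * (e - b) = (s e - s b) * (e - a) -> c = c0.
  by rewrite /c0 => <-; field; rewrite d1 d4.
case: (eqVneq y a) => [->|ya]; first by rewrite !subrr !(mulr0, mul0r).
case: (eqVneq y b) => [->|yb]; first by rewrite !subrr !(mulr0, mul0r).
(* Five points to avoid and [k.-2] to choose: this takes the full bound [k <= #|F| - 3]. *)
have [|K [uK sK Knot]] := @uniq_avoiding F [:: 0; a; b; e; y] k.-2.
  by apply: leq_trans card_bound; rewrite /= !addSn add0n k2_succ.
have K_notin u : u \in K -> [/\ u != 0, u != a, u != b, u != e & u != y].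
  by move=> /Knot; rewrite !inE !negb_or => /and5P[].
have K0 : {in K, forall u, u != 0} by move=> u /K_notin[].
have aK : a \notin K by apply/negP => /K_notin[_ /eqP].
have bK : b \notin K by apply/negP => /K_notin[_ _ /eqP].
have eK : e \notin K by apply/negP => /K_notin[_ _ _ /eqP].
have yK : y \notin K by apply/negP => /K_notin[_ _ _ _ /eqP].
have mw v : v != 0 -> v \notin K -> exists2 c, c != 0 & forall y, y != 0 ->
    g (s y) * ((s y - s v) * \prod_(u <- K) (s y - s u)) =
    c * (g y * ((y - v) * \prod_(u <- K) (y - u))).
  move=> v0 vK; have [|||c cn cE] := symmetry_min_weight (rs := v :: K).
  - by rewrite /= vK.
  - by rewrite /= sK -[in RHS]k2_succ.
  - by move=> u; rewrite inE => /orP[/eqP ->|/K0].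
  by exists c => // x x0; have := cE x x0; rewrite !big_cons.
have [ca ca0 caE] := mw a a0 aK; have [cb cb0 cbE] := mw b b0 bK.
have rel x : x != 0 -> x \notin K ->
    cb / ca * (s x - s a) * (x - b) = (s x - s b) * (x - a).
  move=> x0 xK; have := caE x x0; have := cbE x x0.
  have := prod_XsubC_neq0 (notin_map_s K0 x0 xK); rewrite big_map.
  have := prod_XsubC_neq0 xK; have := g0 x0; have := g0 (s0 x0).
  move: (g (s x)) (g x) (\prod_(_ <- _) _) (\prod_(_ <- _) _).
  move=> gs' gx P' P gs'0 gx0 P0 P'0 hb ha.
  have nz : gs' * gx * P * P' * ca != 0 by rewrite !mulf_neq0.
  apply: (mulfI nz).
  transitivity ((gs' * ((s x - s a) * P')) * (cb * (gx * ((x - b) * P)))).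
    by field.
  by rewrite ha -hb; ring.
by rewrite -(c0E _ (rel e e0 eK)); apply: rel.
Qed.

(** Solved for [s y], the cross-ratio relation reads [(C * y + D) / (A * y + B)]. Neither linear
    factor vanishes on F^*, so each is a constant or a multiple of [y], and a non-zero determinant
    leaves only the two mixed cases. *)
Lemma symmetry_monomial : exists2 a, a != 0 &
  (forall y, y != 0 -> s y = a * y) \/ (forall y, y != 0 -> s y = a / y).
Proof.
have [|K [uK sK K0]] := @uniq_avoiding F [:: 0] 3.
  by apply: leq_trans card_bound; rewrite /= -k2_succ.
case: K sK uK K0 => [|a [|b [|e []]]] //= _.
rewrite !inE negb_or => /and3P[/andP[ab ea] eb _] K0.
have /[!inE] a0 := K0 a (mem_head _ _).
have b0 : b != 0 by have := K0 b; rewrite !inE eqxx orbT => /(_ isT).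
have e0 : e != 0 by have := K0 e; rewrite !inE eqxx !orbT => /(_ isT).
rewrite eq_sym in ea; rewrite eq_sym in eb.
have [c c0 cE] := symmetry_cross_ratio a0 b0 ab e0 ea eb.
pose A := c - 1; pose B := a - c * b.
pose C := c * s a - s b; pose D := s b * a - c * s a * b.
have sE y : y != 0 -> s y * (A * y + B) = C * y + D.
  move=> y0; apply: subr0_eq.
  transitivity (c * (s y - s a) * (y - b) - (s y - s b) * (y - a)).
    by rewrite /A /B /C /D; ring.
  by rewrite cE // subrr.
have det0 : A * D - B * C != 0.
  have -> : A * D - B * C = c * ((a - b) * (s b - s a)).
    by rewrite /A /B /C /D; ring.
  rewrite !mulf_neq0 ?subr_eq0 //; apply: contra_neq ab => /s_inj.
  by move=> ->.
(* A zero of the denominator would be one of the numerator too, which forces the determinant to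
   vanish. *)
have den0 y : y != 0 -> A * y + B != 0.
  move=> y0; apply: contra_neq det0 => AB; have := sE y y0.
  rewrite AB mulr0 => /esym CD.
  have -> : A * D - B * C = A * (C * y + D) - C * (A * y + B) by ring.
  by rewrite AB CD !mulr0 subrr.
have num0 y : y != 0 -> C * y + D != 0.
  by move=> y0; rewrite -sE // mulf_neq0 ?s0 ?den0.
have zero (u v : F) : (forall y, y != 0 -> u * y + v != 0) -> u = 0 \/ v = 0.
  move=> uv; case: (eqVneq u 0) => [|u0]; first by left.
  case: (eqVneq v 0) => [|v0]; first by right.
  have /uv : - v / u != 0 by rewrite mulf_neq0 ?oppr_eq0 ?invr_eq0.
  by rewrite mulrC divfK // addNr eqxx.
case: (zero _ _ den0) (zero _ _ num0) => [A0|B0] [C0|D0].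
- by rewrite A0 C0 mul0r mulr0 subrr eqxx in det0.
- have B0 : B != 0 by apply: contraNneq det0 => ->; rewrite A0 !mul0r subrr.
  have C0 : C != 0 by apply: contraNneq det0 => ->; rewrite A0 mulr0 mul0r subrr.
  exists (C / B); first by rewrite mulf_neq0 ?invr_eq0.
  left=> y y0; have := sE y y0; rewrite A0 D0 mul0r add0r addr0 => h.
  by apply: (mulIf B0); rewrite h; field.
- have A0 : A != 0 by apply: contraNneq det0 => ->; rewrite B0 !mul0r subrr.
  have D0 : D != 0 by apply: contraNneq det0 => ->; rewrite B0 mulr0 mul0r subrr.
  exists (D / A); first by rewrite mulf_neq0 ?invr_eq0.
  right=> y y0; have := sE y y0; rewrite B0 C0 mul0r add0r addr0 => h.
  have Ay := mulf_neq0 A0 y0.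
  by apply: (mulIf Ay); rewrite h; field; rewrite A0 y0.
- by rewrite B0 D0 mul0r mulr0 subrr eqxx in det0.
Qed.

End SymmetriesAreMonomial.

(** * Dihedral groups *)

Section Dihedral.
Variable gT : finGroupType.
Implicit Types (G : {group gT}) (x t : gT).
Local Open Scope group_scope.

(** Conjugations by [b] and by its inverse agree, because [b ^+ 2 = 1]. This links [is_dihedral] to
    the presentation in [Grp_dihedral]. *)
Lemma conj_presentation_dihedral (rT : finGroupType) (H : {group rT}) m :
  (H \homg Grp (a : b : a ^+ m, b ^+ 2, b * a * b^-1 = a^-1)) =
  (H \homg Grp (x : y : x ^+ m, y ^+ 2, x ^ y = x^-1)).
Proof.
apply/existsP/existsP => [] [[x y]] /=; rewrite !xpair_eqE;
  case/and4P=> defH xm y2 r; exists (x, y); rewrite /= !xpair_eqE defH xm y2 /=.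
  have yV : y^-1 = y by apply/eqP; rewrite eq_invg_mul -(expgS y 1).
  by rewrite conjgE mulgA yV -{2}yV.
have yV : y^-1 = y by apply/eqP; rewrite eq_invg_mul -(expgS y 1).
by rewrite -mulgA yV -{1}yV -conjgE.
Qed.

Lemma is_dihedral_gens G m x t : (1 < m)%N -> #|G| = m.*2 ->
  G = <[x]> <*> <[t]> :> {set gT} -> x ^+ m = 1 -> t ^+ 2 = 1 ->
  x ^ t = x^-1 -> is_dihedral G.
Proof.
move=> m_gt1 oG defG xm t2 xt; exists m; first exact: ltnW.
have isoD := Grp_dihedral m_gt1.
have : G \isog 'D_(m.*2).
  apply/(isoGrpP _ isoD); rewrite card_dihedral //; split=> //.
  by apply/existsP; exists (x, t); rewrite /= !xpair_eqE xm t2 xt -defG !eqxx.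
move=> isoGD rT H; rewrite conj_presentation_dihedral.
exact: isoGrp_trans isoGD isoD _ H.
Qed.

Lemma is_dihedralP G : (2 < #|G|)%N -> is_dihedral G ->
  exists m x t, [/\ (1 < m)%N, #|G| = m.*2, #[x] = m,
    [/\ t ^+ 2 = 1, t * x = x^-1 * t, t \notin <[x]>, x \in G & t \in G] &
    forall z, z \in G -> exists i (b : bool), z = x ^+ i * t ^+ b].
Proof.
move=> oG [m m_gt0 isoG].
have : G \homg Grp (x : y : x ^+ m, y ^+ 2, x ^ y = x^-1).
  by rewrite -conj_presentation_dihedral; apply: isoGrp_hom isoG.
case/existsP=> [[x t]] /=; rewrite !xpair_eqE => /and4P[/eqP defG /eqP xm /eqP t2 /eqP xt].
have ox : (#[x] <= m)%N by rewrite dvdn_leq // order_dvdn xm.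
have ot : (#[t] <= 2)%N by rewrite dvdn_leq // order_dvdn t2.
have nxt : <[t]> \subset 'N(<[x]>).
  by rewrite cycle_subG; apply/normP; rewrite -cycleJ xt cycleV.
have defG' : G = <[x]> * <[t]> :> {set gT} by rewrite -norm_joinEr.
have oG' := mul_cardG <[x]> <[t]>; rewrite -defG' /= -!orderE in oG'.
have m_gt1 : (1 < m)%N.
  rewrite ltnNge; apply/negP => m_le1; move: oG'.
  have /eqP -> : #[x] == 1%N by rewrite eqn_leq order_gt0 (leq_trans ox).
  have := cardG_gt0 (<[x]> :&: <[t]>); move: #|_ :&: _| oG => j.
  by rewrite mul1n; move: #|G| #[t] ot => a b; nia.
have oGm : #|G| = m.*2.
  rewrite -(card_dihedral m_gt1); apply: card_isog.
  have isoD := Grp_dihedral m_gt1.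
  rewrite isogEhom isoD -conj_presentation_dihedral isoGrp_hom //=.
  by rewrite isoG conj_presentation_dihedral isoGrp_hom.
(* The orders of [x] and [t] are at most [m] and 2, while their product is [m.*2] times the order of
   the intersection, so all bounds are attained. *)
have [oxm ott oI] : [/\ #[x] = m, #[t] = 2 & #|<[x]> :&: <[t]>| = 1%N].
  have := cardG_gt0 (<[x]> :&: <[t]>); move: oG'; rewrite oGm.
  by move: #|_ :&: _| #[x] #[t] ox ot => j a b; split; nia.
exists m, x, t; split=> //.
  split=> //.
  - have tV : t^-1 = t by apply/eqP; rewrite eq_invg_mul -(expgS t 1) t2.
    by rewrite -xt conjgE -!mulgA tV -(expgS t 1) t2 mulg1.
  - apply: contraTN isT => tx; have : t \in <[x]> :&: <[t]> by rewrite inE tx cycle_id.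
    have /eqP := oI; rewrite -trivg_card1 => /eqP ->.
    by rewrite inE -order_eq1 ott.
  - by rewrite -defG mem_gen // inE cycle_id.
  - by rewrite -defG mem_gen // inE cycle_id orbT.
move=> z; rewrite defG' => /mulsgP[_ _ /cycleP[i ->] /cycleP[j ->] ->].
exists i, (odd j); rewrite -[in LHS](odd_double_half j) expgD -mul2n expgM t2.
by rewrite expg1n mulg1.
Qed.

(** In an abelian group the dihedral relation gives [x ^+ 2 = 1], so [x] and [t] would generate two
    distinct subgroups of order 2 in a cyclic group. *)
Lemma cyclic_not_dihedral G : (2 < #|G|)%N -> cyclic G -> ~ is_dihedral G.
Proof.
move=> oG cG /(is_dihedralP oG)[m [x [t [m_gt1 _ ox [t2 tx t_notin Gx Gt] _]]]].
have xt : commute t x by apply: (centsP (cyclic_abelian cG)).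
have x2 : x ^+ 2 = 1.
  apply/eqP; rewrite expgS expg1 -eq_invg_mul; apply/eqP/(mulIg t).
  by rewrite -tx xt.
have ox2 : #[x] = 2.
  apply/eqP; rewrite eqn_leq ox m_gt1 andbT -ox dvdn_leq // order_dvdn x2.
  by rewrite eqxx.
have ot : #[t] = 2.
  apply: nt_prime_order => //; apply: contraNneq t_notin => ->.
  exact: group1.
have : <[x]> == <[t]>.
  by rewrite (eq_subG_cyclic cG) ?cycle_subG // -!orderE ox2 ot.
by move/eqP=> eq_xt; rewrite eq_xt cycle_id in t_notin.
Qed.

End Dihedral.

(** * Regular group actions on F^* *)

Section SymmetricLabellings.
Variable F : finFieldType.

Lemma units_surj (I : finType) (A : {set I}) (f : I -> F) :
  #|A| = #|F|.-1 -> {in A, forall x, f x != 0} -> {in A &, injective f} ->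
  forall y, y != 0 -> exists2 x, x \in A & f x = y.
Proof.
move=> oA f0 injf y y0; have : y \in [set~ 0] by rewrite !inE.
suff <- : f @: A = [set~ 0] by case/imsetP=> x Ax ->; exists x.
apply/eqP; rewrite eqEcard card_in_imset // cardsC1 oA leqnn andbT.
by apply/subsetP=> _ /imsetP[x Ax ->]; rewrite !inE f0.
Qed.

Section Labelling.
Variables (k : nat) (g : F -> F) (gT : finGroupType) (G : {group gT}).
Implicit Types (psi : gT -> F) (h : gT).

(* [psi] identifies G with F^*, the coordinate set of the code; left translation
   by [h] is required to preserve the code. *)
Definition translation_symmetry psi h :=
  forall p : {poly F}, (size p <= k)%N -> exists2 p' : {poly F}, (size p' <= k)%N &
    {in G, forall x,
      g (psi (h * x)%g) * p.[psi (h * x)%g] = g (psi x) * p'.[psi x]}.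

Definition symmetric_labelling psi :=
  [/\ {in G, forall x, psi x != 0}, {in G &, injective psi} &
      {in G, forall h, translation_symmetry psi h}].

Lemma translation_symmetryM psi h1 h2 : h2 \in G ->
  translation_symmetry psi h1 -> translation_symmetry psi h2 ->
  translation_symmetry psi (h1 * h2)%g.
Proof.
move=> Gh2 sym1 sym2 p /sym1[p1 /sym2[p2 sp2 p2E] p1E].
by exists p2 => // x Gx; rewrite -mulgA p1E ?groupM // p2E.
Qed.

Lemma translation_symmetryX psi h i : h \in G ->
  translation_symmetry psi h -> translation_symmetry psi (h ^+ i)%g.
Proof.
move=> Gh symh; elim: i => [|i IHi]; last first.
  by rewrite expgS; apply: translation_symmetryM; rewrite ?groupX.
by move=> p sp; exists p => // x Gx; rewrite expg0 mul1g.
Qed.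

Lemma translation_symmetry_codeP psi h s :
  {in G, forall x, psi x != 0} ->
  (forall y, y != 0 -> exists2 x, x \in G & psi x = y) ->
  {in G, forall x, psi (h * x)%g = s (psi x)} ->
  translation_symmetry psi h <-> code_symmetry k g s.
Proof.
move=> psi0 surj hs; split=> sym p /sym[p' sp' p'E]; exists p' => //.
  by move=> y /surj[x Gx <-]; rewrite -hs ?p'E.
by move=> x Gx; rewrite hs // p'E ?psi0.
Qed.

(** The index set ['I_n] is eliminated: [psi] is the composite of the bijection from [G] to the
    indices and the enumeration [beta] of F^*. *)
Lemma left_G_code_labellingP n (beta : 'I_n -> F) (C : {vspace 'rV[F]_n}) :
  n = #|F|.-1 -> injective beta -> (forall i, beta i != 0) ->
  (forall v, v \in C <-> scaled_poly_code k g beta v) ->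
  left_G_code G C <-> #|G| = #|F|.-1 /\ exists psi, symmetric_labelling psi.
Proof.
move=> nE inj_beta beta0 memC.
have beta_surj y : y != 0 -> exists i, beta i = y.
  move=> y0; have oI : #|[set: 'I_n]| = #|F|.-1 by rewrite cardsT card_ord.
  have [i _ <-] := units_surj oI (fun i _ => beta0 i) (in2W inj_beta) y0.
  by exists i.
rewrite left_G_codeP; split=> [[oG [phi [phi' [phiG phiK phi'K Cact]]]]|].
  split; first by rewrite oG.
  exists (beta \o phi'); split=> [x _ /=|x y Gx Gy /= /inj_beta eq_xy|h Gh p sp].
  - exact: beta0.
  - by rewrite -(phi'K x Gx) eq_xy phi'K.
  have /(Cact _ _ Gh) : \row_i (g (beta i) * p.[beta i]) \in C.
    by apply/memC; exists p.
  case/memC=> p' sp' /rowP p'E; exists p' => // x Gx.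
  by have := p'E (phi' x); rewrite !mxE phi'K.
case=> oG [psi [psi0 psi_inj symG]]; split; first by rewrite oG.
have surj := units_surj oG psi0 psi_inj.
pose phi i := odflt 1%g [pick x in G | psi x == beta i].
have phiP i : phi i \in G /\ psi (phi i) = beta i.
  rewrite /phi; case: pickP => [x /andP[Gx /eqP]|] //.
  by have [x Gx xi] := surj _ (beta0 i) => /(_ x); rewrite Gx xi eqxx.
have n_gt0 : (0 < n)%N by rewrite nE -oG cardG_gt0.
pose phi' x := odflt (Ordinal n_gt0) [pick i | beta i == psi x].
have phi'P x : x \in G -> beta (phi' x) = psi x.
  move=> Gx; rewrite /phi'; case: pickP => [i /eqP|] //.
  by have [i xi] := beta_surj _ (psi0 _ Gx) => /(_ i); rewrite xi eqxx.
have phiG i : phi i \in G by have [] := phiP i.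
exists phi, phi'; split=> [//|i|x Gx|h v Gh /memC[p sp ->]].
- by apply: inj_beta; rewrite phi'P //; have [] := phiP i.
- by apply: psi_inj => //; have [_ ->] := phiP (phi' x); apply: phi'P.
have [p' sp' p'E] := symG h Gh p sp.
apply/memC; exists p' => //; apply/rowP => i; rewrite !mxE.
have [_ <-] := phiP i; rewrite phi'P ?groupM //.
by rewrite p'E.
Qed.

End Labelling.

Variables (k : nat) (g : F -> F).
Hypotheses (k_ge2 : (2 <= k)%N) (k_le : (k <= #|F| - 3)%N).
Hypothesis g0 : forall y, y != 0 -> g y != 0.
Variables (gT : finGroupType) (G : {group gT}) (psi : gT -> F).
Hypothesis oG : #|G| = #|F|.-1.

(** Here and in [inverts], the last clause is the functional equation to which [scale_symmetryP] or
    [inverse_symmetryP] reduces preservation of the code. *)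
Definition scales h a := [/\ a != 0, {in G, forall x, psi (h * x)%g = a * psi x} &
  exists c, forall y, y != 0 -> g (a * y) = c * g y].

Definition inverts h a := [/\ a != 0, {in G, forall x, psi (h * x)%g = a / psi x} &
  exists c, forall y, y != 0 -> g (a / y) = c * (y ^+ k.-1 * g y)].

Lemma symmetric_labelling_translations : symmetric_labelling k g G psi ->
  {in G, forall h, exists a, scales h a \/ inverts h a}.
Proof.
case=> psi0 psi_inj symG h Gh; have surj := units_surj oG psi0 psi_inj.
(* Left translation read on the labels; the default 1 matters at [y = 0] only. *)
pose s y := psi (h * odflt 1 [pick x in G | psi x == y])%g.
have sE : {in G, forall x, psi (h * x)%g = s (psi x)}.
  move=> x Gx; rewrite /s; case: pickP => [z /andP[Gz /eqP/psi_inj -> //]|].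
  by move/(_ x); rewrite Gx eqxx.
have sym := symG h Gh.
have {}sym := (translation_symmetry_codeP k g psi0 surj sE).1 sym.
have s0 y : y != 0 -> s y != 0.
  by move=> /surj[x Gx <-]; rewrite -sE // psi0 ?groupM.
have s_inj x y : x != 0 -> y != 0 -> s x = s y -> x = y.
  move=> /surj[u Gu <-] /surj[v Gv <-]; rewrite -!sE // => /psi_inj.
  by rewrite !groupM // => /(_ isT isT)/mulgI ->.
have [a a0 [sa|sa]] := symmetry_monomial k_ge2 k_le g0 s0 s_inj sym.
  exists a; left; split=> // [x Gx|]; first by rewrite sE // sa ?psi0.
  exact/(scale_symmetryP k_ge2 k_le a0 g0 sa).
exists a; right; split=> // [x Gx|]; first by rewrite sE // sa ?psi0.
exact/(inverse_symmetryP k_ge2 k_le a0 g0 sa).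
Qed.

Hypothesis psi0 : {in G, forall x, psi x != 0}.
Hypothesis psi_inj : {in G &, injective psi}.

Lemma scales_translation_symmetry h a :
  scales h a -> translation_symmetry k g G psi h.
Proof.
case=> a0 ha ga; have surj := units_surj oG psi0 psi_inj.
apply/(translation_symmetry_codeP k g psi0 surj ha).
exact/(scale_symmetryP k_ge2 k_le a0 g0 (s := fun y => a * y)).
Qed.

Lemma inverts_translation_symmetry h a :
  inverts h a -> translation_symmetry k g G psi h.
Proof.
case=> a0 ha ga; have surj := units_surj oG psi0 psi_inj.
apply/(translation_symmetry_codeP k g psi0 surj (s := fun y => a / y) ha).
exact/(inverse_symmetryP k_ge2 k_le a0 g0 (s := fun y => a / y)).
Qed.

End SymmetricLabellings.

(** * From a symmetric labelling to the form of the scaling map *)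

Section PowerMaps.
Variables (F : finFieldType) (k : nat) (xi : F).
Hypotheses (k_ge2 : (2 <= k)%N) (k_le : (k <= #|F| - 3)%N).
Hypothesis prim_xi : (#|F|.-1).-primitive_root xi.
Implicit Type g : F -> F.

(** This and [dihedral_power_map] are [cond1] and [cond2] with an arbitrary map in place of
    [transport k f T]. *)
Definition power_map g := exists m : int, equiv_maps g (fun x => x ^ m).

Definition dihedral_power_map g :=
  odd #|F| /\
  exists m m' : int,
    [/\ (4 * m + 2 * (k.-1)%:Z = 0 %[mod (#|F|.-1)%:Z])%Z,
        (2 * m' + (k.-1)%:Z = 0 %[mod (#|F|.-1)%:Z])%Z &
        exists2 g' : F -> F, is_fmm xi m m' g' & equiv_maps g g'].

Lemma xi_neq0 : xi != 0.
Proof.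
apply: contra_eqN (prim_expr_order prim_xi) => /eqP ->.
by rewrite expr0n eqn0Ngt (prim_order_gt0 prim_xi) eq_sym oner_eq0.
Qed.

Lemma xi_log y : y != 0 -> exists i, y = xi ^+ i.
Proof.
move=> y0; have y1 : y ^+ #|F|.-1 = 1.
  apply: (mulfI y0); rewrite -exprS mulr1 prednK ?expf_card //.
  exact: ltnW (finNzRing_gt1 F).
by have [i ->] := prim_rootP prim_xi y1; exists i.
Qed.

Lemma card_units_gt3 : (3 < #|F|.-1)%N.
Proof.
have : (2 <= #|F| - 3)%N by apply: leq_trans k_le.
by case: #|F| => [|[|[|[|[|q]]]]].
Qed.

Section Forward.
Variables (g : F -> F) (gT : finGroupType) (G : {group gT}) (psi : gT -> F).
Hypothesis g0 : forall y, y != 0 -> g y != 0.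
Hypothesis oG : #|G| = #|F|.-1.
Hypothesis psiG : symmetric_labelling k g G psi.

Let psi0 : {in G, forall x, psi x != 0}. Proof. by case: psiG. Qed.
Let psi_inj : {in G &, injective psi}. Proof. by case: psiG. Qed.
Let surj := units_surj oG psi0 psi_inj.

(** The map [psi h / psi 1] embeds [G] in F^*, so [G] is cyclic. Every unit occurs as a scaling
    factor, hence [g / g 1] is multiplicative on F^* and determined by its value at [xi]. *)
Lemma scaling_labelling_cyclic :
  {in G, forall h, exists a, scales g G psi h a} -> cyclic G /\ power_map g.
Proof.
move=> scG; have psi1 := psi0 (group1 G).
have scE h a : h \in G -> scales g G psi h a -> psi h = a * psi 1%g.
  by move=> Gh [_ /(_ 1%g (group1 G)) ha _]; rewrite mulg1 in ha.
split.
  apply: (@field_mul_group_cyclic _ G F (fun h => psi h / psi 1%g)).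
    move=> h1 h2 Gh1 Gh2; have [a sa] := scG _ Gh1; have [_ ha _] := sa.
    by rewrite ha // (scE _ _ Gh1 sa); field.
  move=> h Gh; split=> [h1|->]; last by rewrite divff.
  apply: psi_inj => //.
  by apply: (mulIf (invr_neq0 psi1)); rewrite h1 divff.
have g1 : g 1 != 0 by rewrite g0 ?oner_neq0.
have gM a y : a != 0 -> y != 0 -> g (a * y) / g 1 = (g a / g 1) * (g y / g 1).
  move=> a0 y0; have [h Gh ha] := surj (mulf_neq0 a0 psi1).
  have [b sb] := scG h Gh; have [_ _ [c cE]] := sb.
  have ab : a = b by apply: (mulIf psi1); rewrite -ha; apply: scE sb.
  by rewrite ab cE // -(mulr1 b) cE ?oner_neq0 //; field.
have gxi : g xi / g 1 != 0 by rewrite mulf_neq0 ?invr_eq0 // g0 ?xi_neq0.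
have [m mE] := xi_log gxi; exists (Posz m).
exists (g 1)^-1 => [|x]; first by rewrite invr_eq0.
move=> /xi_log[i ->]; rewrite -exprnP mulrC -exprM mulnC exprM -mE.
elim: i => [|i IHi]; first by rewrite !expr0 divff.
by rewrite !exprS gM ?expf_neq0 ?xi_neq0 // -IHi.
Qed.

(** The parity of the exponent of [xi] separates the translations: even for scalings, odd for
    inversions. The scaling by [xi ^+ 2] and the inversion with constant [xi] both occur and
    generate [G]; the functional equations along these two determine [g] up to a scalar and yield
    the congruences. *)
Lemma inverting_labelling_dihedral t e : t \in G -> inverts k g G psi t e ->
  is_dihedral G /\ dihedral_power_map g.
Proof.
move=> Gt invt; have psi1 := psi0 (group1 G); have xi0 := xi_neq0.
have trans := symmetric_labelling_translations k_ge2 k_le g0 oG psiG.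
have N3 := card_units_gt3.
have scE h a : h \in G -> scales g G psi h a -> psi h = a * psi 1%g.
  by move=> Gh [_ /(_ 1%g (group1 G)) ha _]; rewrite mulg1 in ha.
have invE h a : h \in G -> inverts k g G psi h a -> psi h = a / psi 1%g.
  by move=> Gh [_ /(_ 1%g (group1 G)) ha _]; rewrite mulg1 in ha.
(* An inverting translation y |-> b / y has no fixed point. *)
have nsq b y : b = y ^+ 2 -> y != 0 -> ~ exists2 h, h \in G & inverts k g G psi h b.
  move=> def_b y0 [h Gh [_ hb _]]; have [x Gx xy] := surj y0.
  have := hb x Gx; rewrite xy def_b expr2 mulfK // -xy.
  move/psi_inj; rewrite groupM // => /(_ isT Gx).
  move/(canRL (mulgK x)); rewrite mulgV => h1.
  have [z Gz zE] : exists2 z, z \in G & psi z = xi * y.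
    by apply: surj; rewrite mulf_neq0.
  have := hb z Gz; rewrite h1 mul1g zE def_b => /eqP.
  rewrite -subr_eq0 => /eqP eq0.
  have : xi ^+ 2 = 1.
    apply: (mulIf y0); apply: (mulIf xi0); apply: subr0_eq.
    by rewrite -[RHS](mulr0 xi) -[in RHS](mulr0 xi) -eq0; field; rewrite xi0 y0.
  move/eqP; rewrite -(prim_order_dvd prim_xi) => /dvdn_leq.
  by move/(_ isT); rewrite leqNgt (ltn_trans _ N3).
have inv_odd h b i : h \in G -> inverts k g G psi h b -> b = xi ^+ i -> odd i.
  move=> Gh hb bi; apply/negP => /negP/even_halfK i2.
  apply: (nsq b (xi ^+ i./2)); rewrite ?expf_neq0 //; last by exists h.
  by rewrite bi -{1}i2 -muln2 exprM.
(* A logarithm of [e] may be shifted by the order of [xi]; both values must be odd, so this order is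
   even. *)
have N2 : ~~ odd #|F|.-1.
  apply/negP => oddN; have [e0 _ _] := invt; have [i ei] := xi_log e0.
  have oddi := inv_odd _ _ _ Gt invt ei.
  suff: odd (i + #|F|.-1) by rewrite oddD oddi oddN.
  by apply: (inv_odd _ _ _ Gt invt); rewrite exprD (prim_expr_order prim_xi) mulr1.
pose M := #|F|.-1./2.
have NM : #|F|.-1 = M.*2 by rewrite /M even_halfK.
(* Translation by [h * t] is [y |-> a * e / y]. As an inversion it has the odd exponent [i + j],
   with [j] odd; as a scaling it would give [xi ^+ 2 = 1], by comparison at [psi 1] and
   [xi * psi 1]. *)
have sc_even h a i : h \in G -> scales g G psi h a -> a = xi ^+ i -> ~~ odd i.
  move=> Gh sa ai; have [a0 ha _] := sa.
  have [e0 te _] := invt; have [j ej] := xi_log e0.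
  have oddj := inv_odd _ _ _ Gt invt ej.
  have Ght : (h * t)%g \in G by rewrite groupM.
  have htE x : x \in G -> psi (h * t * x)%g = (a * e) / psi x.
    by move=> Gx; rewrite -mulgA ha ?groupM // te // mulrA.
  have [b [sb|ib]] := trans _ Ght.
    have [_ hb _] := sb; have [x Gx xE] := surj (mulf_neq0 xi0 psi1).
    have := htE x Gx; rewrite hb // xE; have := htE 1%g (group1 G).
    rewrite hb ?group1 // => e1 e2; exfalso.
    have : xi ^+ 2 = 1.
      apply: (mulIf (mulf_neq0 a0 e0)).
      have -> : xi ^+ 2 * (a * e) = xi ^+ 2 * psi 1%g * (b * psi 1%g).
        by rewrite e1; field.
      have -> : xi ^+ 2 * psi 1%g * (b * psi 1%g) = xi * psi 1%g * (b * (xi * psi 1%g)).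
        by ring.
      by rewrite e2; field; rewrite xi0 psi1.
    move/eqP; rewrite -(prim_order_dvd prim_xi) => /dvdn_leq.
    by move/(_ isT); rewrite leqNgt (ltn_trans _ N3).
  have be : b = xi ^+ (i + j).
    apply: (mulIf (invr_neq0 psi1)); have [_ hb _] := ib.
    by rewrite -hb ?group1 // htE ?group1 // ai ej exprD.
  have := inv_odd _ _ _ Ght ib be.
  by rewrite oddD oddj addbT.
have [w wE] := xi_log psi1.
(* [r] moves [psi 1] to [xi ^+ 2 * psi 1]; as an inversion it would have the square constant
   [(xi * psi 1) ^+ 2]. *)
have [r Gr sr] : exists2 r, r \in G & scales g G psi r (xi ^+ 2).
  have [r Gr rE] := surj (mulf_neq0 (expf_neq0 2 xi0) psi1).
  exists r => //; have [a [sa|ia]] := trans r Gr.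
    suff <- : a = xi ^+ 2 by [].
    by apply: (mulIf psi1); rewrite -rE (scE r a).
  exfalso; have : odd (2 + w + w).
    apply: (inv_odd r a) => //; apply: (mulIf (invr_neq0 psi1)).
    by rewrite -(invE r a) // rE !exprD -wE; field.
  by rewrite -addnA oddD addnn odd_double.
(* [s] moves [psi 1] to [xi / psi 1]; as a scaling it would have as factor [xi] divided by a square,
   of odd exponent. *)
have [s Gs is_] : exists2 s, s \in G & inverts k g G psi s xi.
  have [s Gs sE] := surj (mulf_neq0 xi0 (invr_neq0 psi1)).
  exists s => //; have [a [sa|ia]] := trans s Gs; last first.
    suff <- : a = xi by [].
    by apply: (mulIf (invr_neq0 psi1)); rewrite -sE (invE s a).
  exfalso; have [a0 _ _] := sa; have [i ai] := xi_log a0.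
  have := sc_even s a i Gs sa ai; apply/negP; rewrite negbK.
  have : xi ^+ (i + w + w) == xi ^+ 1.
    by rewrite !exprD -ai -wE -(scE s a) // sE divfK.
  rewrite (eq_prim_root_expr prim_xi) => /eqP/(congr1 odd).
  rewrite !odd_mod ?(negbTE N2) // -addnA oddD addnn odd_double addbF.
  by move->.
have [_ rE [c cE]] := sr; have [_ sE [d dE]] := is_.
have rX i x : x \in G -> psi (r ^+ i * x)%g = xi ^+ (2 * i) * psi x.
  move=> Gx; elim: i => [|i IHi]; first by rewrite mul1g mul1r.
  by rewrite expgS -mulgA rE ?groupM ?groupX // IHi mulnS exprD mulrA.
have rM : (r ^+ M = 1)%g.
  apply: psi_inj; rewrite ?groupX ?group1 // -[X in psi X]mulg1 rX ?group1 //.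
  by rewrite mul2n -NM (prim_expr_order prim_xi) mul1r.
have s2 : (s ^+ 2 = 1)%g.
  apply: psi_inj; rewrite ?groupX ?group1 //.
  rewrite expgS expg1 sE // -[X in psi X]mulg1 sE ?group1 //.
  by field; rewrite xi0 psi1.
have sV : (s^-1 = s)%g by apply/eqP; rewrite eq_invg_mul -(expgS s 1) s2.
have rs : (r ^ s = r^-1)%g.
  apply/eqP; rewrite eq_sym eq_invg_mul conjgE sV; apply/eqP.
  apply: psi_inj; rewrite ?group1 ?groupM //.
  rewrite rE ?groupM // sE ?groupM // rE // -[X in psi X]mulg1 sE ?group1 //.
  by field; rewrite xi0 psi1.
have gens x : x \in G -> x \in (<[r]> <*> <[s]>)%G.
  have rG : r \in (<[r]> <*> <[s]>)%G by rewrite mem_gen // in_setU cycle_id.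
  have sG : s \in (<[r]> <*> <[s]>)%G by rewrite mem_gen // in_setU cycle_id orbT.
  move=> Gx; have [a [sa|ia]] := trans x Gx.
    have [a0 _ _] := sa; have [i ai] := xi_log a0.
    have /even_halfK i2 := sc_even x a i Gx sa ai.
    suff -> : x = (r ^+ i./2)%g by rewrite groupX.
    apply: psi_inj; rewrite ?groupX // -[(r ^+ _)%g]mulg1 rX ?group1 //.
    by rewrite mul2n i2 -ai; apply: scE.
  have [a0 _ _] := ia; have [i ai] := xi_log a0.
  have oddi := inv_odd x a i Gx ia ai.
  suff -> : x = (r ^+ i./2 * s)%g by rewrite groupM ?groupX.
  apply: psi_inj; rewrite ?groupM ?groupX // rX //.
  rewrite (invE s xi) // (invE x a) // ai -{1}(odd_double_half i) oddi.
  by rewrite exprS mul2n; ring.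
split.
  apply: (@is_dihedral_gens _ G M r s) => //.
  - by rewrite -ltn_double -NM (leq_ltn_trans _ N3).
  - by rewrite oG NM.
  apply/eqP; rewrite eqEsubset join_subG !cycle_subG Gr Gs !andbT.
  by apply/subsetP => x /gens.
split; first by move: N2 N3; case: #|F| => [|q] //=; rewrite negbK.
have g1 : g 1 != 0 by rewrite g0 ?oner_neq0.
have g1E y : g 1 * (g y / g 1) = g y by rewrite mulrC divfK.
(* Normalized at 1, so that [c] and [d] become the values at [xi ^+ 2] and [xi]. *)
pose g' y := g y / g 1.
have g'0 y : y != 0 -> g' y != 0 by move=> y0; rewrite mulf_neq0 ?invr_eq0 // g0.
have g'1 : g' 1 = 1 by rewrite /g' divff.
have g'r y : y != 0 -> g' (xi ^+ 2 * y) = c * g' y.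
  by move=> y0; rewrite /g' cE // mulrA.
have g's y : y != 0 -> g' (xi / y) = d * (y ^+ k.-1 * g' y).
  by move=> y0; rewrite /g' dE // !mulrA.
have g'rX i y : y != 0 -> g' (xi ^+ (2 * i) * y) = c ^+ i * g' y.
  move=> y0; elim: i => [|i IHi]; first by rewrite !mul1r.
  by rewrite mulnS exprD -mulrA g'r ?mulf_neq0 ?expf_neq0 // IHi exprS mulrA.
have c0 : c != 0.
  have : g' (xi ^+ 2 * 1) != 0 by rewrite g'0 ?mulr1 ?expf_neq0.
  by rewrite g'r ?oner_neq0 // g'1 mulr1.
have dxi : d = g' xi.
  by have := g's 1 (oner_neq0 _); rewrite divr1 expr1n mul1r g'1 mulr1.
have d0 : d != 0 by rewrite dxi g'0.
have [i ci] := xi_log c0; have [m' dm'] := xi_log d0.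
have cM : c ^+ M = 1.
  have := g'rX M 1 (oner_neq0 _).
  by rewrite mul2n -NM (prim_expr_order prim_xi) !mulr1 g'1 mulr1.
(* [c ^+ M = 1] in a cyclic group of order [M.*2] makes [c] a square, which provides [m]. *)
have i_even : ~~ odd i.
  have : (#|F|.-1 %| i * M)%N by rewrite (prim_order_dvd prim_xi) exprM -ci cM.
  rewrite NM -mul2n dvdn_pmul2r ?dvdn2 //.
  by rewrite -double_gt0 -NM (leq_ltn_trans _ N3).
pose m := i./2; have cm : c = xi ^+ (2 * m) by rewrite mul2n even_halfK.
(* The inversion relation at [xi] reads [1 = d * (xi ^+ k.-1 * d)]. *)
have rel1 : xi ^+ (2 * m' + k.-1) = 1.
  have := g's xi xi0; rewrite divff // g'1 -dxi => ->.
  by rewrite mul2n -addnn !exprD -dm'; ring.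
(* The inversion relation at [xi ^+ 2], multiplied by [c] to shift the argument from the inverse of
   [xi] back to [xi]. *)
have rel2 : xi ^+ (4 * m + 2 * k.-1) = 1.
  have g'2 : g' (xi ^+ 2) = c by rewrite -[xi ^+ 2]mulr1 g'r ?oner_neq0 // g'1 mulr1.
  have := g's _ (expf_neq0 2 xi0); rewrite g'2.
  move/(congr1 (fun y => c * y)); rewrite -g'r ?mulf_neq0 ?invr_eq0 ?expf_neq0 //.
  have -> : xi ^+ 2 * (xi / xi ^+ 2) = xi by field.
  rewrite -dxi => e1; apply: (mulfI d0); rewrite mulr1 [RHS]e1.
  rewrite exprD -[4%N]/(2 + 2)%N mulnDl exprD -cm exprM.
  by move: (_ ^+ k.-1) => u; ring.
have modN (j : nat) : xi ^+ j = 1 -> (j%:Z = 0 %[mod (#|F|.-1)%:Z])%Z.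
  move/eqP; rewrite -(prim_order_dvd prim_xi) => Nj.
  by apply/eqP; rewrite eqz_mod_dvd subr0 dvdzE.
exists m%:Z, m'%:Z; split.
- by rewrite -!PoszM -PoszD modN.
- by rewrite -!PoszM -PoszD modN.
exists g'; last by exists (g 1)^-1; rewrite ?invr_eq0 // => x _; rewrite mulrC.
move=> u b b_lt2; have xib : xi ^+ b != 0 by rewrite expf_neq0.
have g'b : g' (xi ^+ b) = xi ^+ (b * m').
  case: b b_lt2 {xib} => [|[|]] // _.
  by rewrite expr1 -dxi dm' mul1n.
rewrite !expfzDr // -[xi ^ b%:Z]exprnP -PoszM -[xi ^ (b * m')%N]exprnP -g'b.
case: u => u.
  by rewrite -!PoszM -!exprnP g'rX // cm -exprM mulnAC.
(* For a negative exponent, [g'rX] is applied at the point itself and solved for the value there. *)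
rewrite NegzE mulrN mulNr -!PoszM -!exprnN -[(1 + 1)%N]/2%N.
have xu : xi ^+ (2 * u.+1) != 0 by rewrite expf_neq0.
have h := g'rX u.+1 _ (mulf_neq0 (invr_neq0 xu) xib).
rewrite mulVKf // in h; rewrite h cm -exprM.
by rewrite mulnAC mulKf // expf_neq0.
Qed.

End Forward.
End PowerMaps.

(** Lets a labelling be prescribed on words in generators, once words for the same element get the
    same value; [r0] is the value off the image of [e]. *)
Lemma factor_through (I : finType) (T : eqType) (R : Type) (r0 : R)
    (e : I -> T) (v : I -> R) :
  (forall i j, e i = e j -> v i = v j) -> exists psi, forall i, psi (e i) = v i.
Proof.
move=> ev; exists (fun x => oapp v r0 [pick i | e i == x]) => i.
by case: pickP => [j /eqP/ev | /(_ i)] //=; rewrite eqxx.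
Qed.

(** * From the form of the scaling map to a symmetric labelling *)

Section Labellings.
Variables (F : finFieldType) (k : nat) (xi : F) (g : F -> F).
Hypotheses (k_ge2 : (2 <= k)%N) (k_le : (k <= #|F| - 3)%N).
Hypothesis prim_xi : (#|F|.-1).-primitive_root xi.
Hypothesis g0 : forall y, y != 0 -> g y != 0.
Variables (gT : finGroupType) (G : {group gT}).
Hypothesis oG : #|G| = #|F|.-1.

Lemma labelling_inj (psi : gT -> F) :
  (forall y, y != 0 -> exists2 x, x \in G & psi x = y) -> {in G &, injective psi}.
Proof.
move=> surj; apply/imset_injP; rewrite eqn_leq leq_imset_card oG -(cardsC1 0).
apply/subset_leq_card/subsetP => y; rewrite !inE => /surj[x Gx <-].
exact: imset_f.
Qed.

Lemma cyclic_symmetric_labelling : cyclic G -> power_map g ->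
  exists psi, symmetric_labelling k g G psi.
Proof.
move=> /cyclicP[h defG] [m [lambda lambda0 gE]].
have oh : #[h]%g = #|F|.-1 by rewrite orderE -defG.
have xi0 := xi_neq0 prim_xi.
have [|psi0 psi0E] := factor_through 0 (e := fun i : 'I_#|F|.-1 => (h ^+ i)%g)
    (v := fun i => xi ^+ i).
  move=> i j /eqP; rewrite eq_expg_mod_order oh => ij; apply/eqP.
  by rewrite (eq_prim_root_expr prim_xi).
have psiE i : psi0 (h ^+ i)%g = xi ^+ i.
  rewrite -(prim_expr_mod prim_xi) -oh -expg_mod_order oh.
  have lt_i : (i %% #|F|.-1 < #|F|.-1)%N by rewrite ltn_mod (prim_order_gt0 prim_xi).
  exact: (psi0E (Ordinal lt_i)).
have GE x : x \in G -> exists i, x = (h ^+ i)%g.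
  by rewrite defG => /cycleP[i ->]; exists i.
have nz : {in G, forall x, psi0 x != 0}.
  by move=> x /GE[i ->]; rewrite psiE expf_neq0.
have inj : {in G &, injective psi0}.
  apply: labelling_inj => y /(xi_log prim_xi)[i ->]; exists (h ^+ i)%g => //.
  by rewrite defG mem_cycle.
exists psi0; split=> // x /GE[j ->].
apply: (scales_translation_symmetry k_ge2 k_le g0 oG nz inj (a := xi ^+ j)).
split=> [|y /GE[i ->]|]; first exact: expf_neq0.
  by rewrite -expgD !psiE exprD.
have xij := expf_neq0 j xi0.
exists ((xi ^+ j) ^ m) => y y0; apply: (mulfI lambda0).
by rewrite -gE ?mulf_neq0 // expfzMl (gE y) // mulrCA.
Qed.

Lemma expz_mod_order (j : int) : (j = 0 %[mod (#|F|.-1)%:Z])%Z -> xi ^ j = 1.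
Proof.
move=> /eqP; rewrite eqz_mod_dvd subr0 => /dvdzP[u ->].
by rewrite mulrC -exprz_exp -exprnP (prim_expr_order prim_xi) exp1rz.
Qed.

(** The label of [x ^+ i * t ^+ b] is [xi ^+ (2 * i + b)], so the powers of [x] carry the squares.
    Translation by [x] becomes [y |-> xi ^+ 2 * y], translation by [t] becomes [y |-> xi / y], and
    checking these two generators suffices. *)
Lemma dihedral_symmetric_labelling : is_dihedral G -> dihedral_power_map k xi g ->
  exists psi, symmetric_labelling k g G psi.
Proof.
have N3 := card_units_gt3 k_ge2 k_le; have xi0 := xi_neq0 prim_xi.
have oG3 : (2 < #|G|)%N by rewrite oG ltnW.
move=> /(is_dihedralP oG3)[M [x [t [M_gt1 oGM ox [t2 tx t_notin Gx Gt] GE]]]].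
move=> [_ [m [m' [rel1 rel2 [g' g'E [lambda lambda0 gE]]]]]].
have NM : #|F|.-1 = (2 * M)%N by rewrite -oG oGM mul2n.
have xiM i : xi ^+ (2 * i) = xi ^+ (2 * (i %% M)).
  rewrite [in LHS](divn_eq i M) mulnDr exprD mulnCA -NM mulnC exprM.
  by rewrite (prim_expr_order prim_xi) expr1n mul1r.
have [|psi psi0E] := factor_through 0
    (e := fun p : 'I_M * bool => (x ^+ p.1 * t ^+ p.2)%g)
    (v := fun p => xi ^+ (2 * p.1 + p.2)).
  case=> [i b] [j c] /= eq_ij; suff eq_bc : b = c.
    move: eq_ij; rewrite eq_bc => /mulIg/eqP.
    rewrite eq_expg_mod_order ox => /eqP ij.
    by rewrite [LHS]exprD xiM ij -xiM -exprD.
  (* If the exponents of [t] differed, [t] itself would lie in [<[x]>]. *)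
  have: (t ^+ b * (t ^+ c)^-1 \in <[x]>)%g.
    have -> : (t ^+ b * (t ^+ c)^-1 = x ^- i * x ^+ j)%g.
      by rewrite -(mulKg (x ^+ i)%g (t ^+ b)%g) eq_ij !mulgA mulgK.
    by rewrite groupM ?groupV ?mem_cycle.
  case: b {eq_ij}; case: c => //=; rewrite ?expg0 ?expg1 ?mul1g ?invg1 ?mulg1 ?groupV.
    by rewrite (negPf t_notin).
  by rewrite (negPf t_notin).
have psiE i (b : bool) : psi (x ^+ i * t ^+ b)%g = xi ^+ (2 * i + b).
  rewrite exprD xiM -exprD -expg_mod_order ox.
  have lt_i : (i %% M < M)%N by rewrite ltn_mod ltnW.
  exact: (psi0E (Ordinal lt_i, b)).
have nz : {in G, forall z, psi z != 0}.
  by move=> z /GE[i [b ->]]; rewrite psiE expf_neq0.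
have inj : {in G &, injective psi}.
  apply: labelling_inj => y /(xi_log prim_xi)[i ->].
  exists (x ^+ i./2 * t ^+ odd i)%g; first by rewrite groupM ?groupX.
  by rewrite psiE addnC mul2n odd_double_half.
have g'log y : y != 0 -> exists (u : nat) (b : bool), y = xi ^+ (2 * u + b).
  by move=> /(xi_log prim_xi)[i ->]; exists i./2, (odd i); rewrite addnC mul2n odd_double_half.
have g'X (u : int) (b : bool) : g' (xi ^ (2 * u + b%:Z)) = xi ^ (2 * u * m + b%:Z * m').
  by apply: g'E; case: b.
have symx : translation_symmetry k g G psi x.
  apply: (scales_translation_symmetry k_ge2 k_le g0 oG nz inj (a := xi ^+ 2)).
  split=> [|z /GE[i [b ->]]|]; first by rewrite expf_neq0.
    by rewrite mulgA -expgS !psiE mulnS -addnA exprD.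
  exists (xi ^ (2 * m)) => y y0; apply: (mulfI lambda0).
  rewrite -gE ?mulf_neq0 ?expf_neq0 // mulrCA -gE //.
  have [u [b ->]] := g'log y y0.
  have -> : xi ^+ 2 * xi ^+ (2 * u + b) = xi ^ (2 * (u%:Z + 1) + b%:Z).
    by rewrite -exprD exprnP; congr (_ ^ _); lia.
  have -> : xi ^+ (2 * u + b) = xi ^ (2 * u%:Z + b%:Z).
    by rewrite exprnP; congr (_ ^ _); lia.
  by rewrite !g'X -expfzDr //; congr (_ ^ _); ring.
have symt : translation_symmetry k g G psi t.
  apply: (inverts_translation_symmetry k_ge2 k_le g0 oG nz inj (a := xi)).
  split=> [//|z /GE[i [b ->]]|].
    (* In exponents of [x], [M.-1] stands for -1 modulo the order [M]. *)
    have tX : (t * x ^+ i = x ^+ (i * M.-1) * t)%g.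
      have xV : (x^-1 = x ^+ M.-1)%g.
        by apply/eqP; rewrite eq_invg_mul -expgS prednK ?(ltnW M_gt1) // -ox expg_order.
      rewrite mulnC expgM -xV; elim: i => [|i IHi]; first by rewrite !expg0 mulg1 mul1g.
      by rewrite !expgSr mulgA IHi -!mulgA tx.
    have -> : (t * (x ^+ i * t ^+ b) = x ^+ (i * M.-1) * t ^+ (~~ b))%g.
      rewrite mulgA tX -mulgA; congr (_ * _)%g.
      by case: b; rewrite ?expg1 ?expg0 ?mulg1 // -t2.
    rewrite !psiE; apply: (mulIf (expf_neq0 (2 * i + b) xi0)).
    rewrite divfK ?expf_neq0 // -exprD.
    have -> : (2 * (i * M.-1) + ~~ b + (2 * i + b) = 2 * M * i + 1)%N.
      by case: b; case: M M_gt1 {NM xiM psi psi0E psiE nz inj ox oGM tX symx} => // M' _ /=; ring.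
    by rewrite exprD -NM exprM (prim_expr_order prim_xi) expr1n mul1r.
  exists (xi ^ m') => y y0; apply: (mulfI lambda0).
  rewrite -gE ?mulf_neq0 ?invr_eq0 // mulrCA (mulrCA lambda) -(gE y) //.
  have [u [b yE]] := g'log y y0.
  have yE' : y = xi ^ (2 * u%:Z + b%:Z) by rewrite yE exprnP; congr (_ ^ _); lia.
  (* The exponent [1 - (2 * u + b)] is split again into an even part and a bit. *)
  have -> : xi / y = xi ^ (2 * - u%:Z + (~~ b)%:Z).
    apply: (mulIf y0); rewrite divfK // yE' -expfzDr //.
    by rewrite -[LHS]expr1z; congr (_ ^ _); case: (b) => /=; lia.
  have -> : y ^+ k.-1 = xi ^ ((2 * u%:Z + b%:Z) * (k.-1)%:Z).
    by rewrite -exprz_exp -yE' exprnP.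
  rewrite yE' !g'X -!expfzDr //.
  rewrite -[LHS]mulr1.
  (* The exponents of the two sides differ by this combination of the two congruences, with
     coefficients [u] and [b]. *)
  rewrite -[X in _ * X = _](_ : xi ^ (u%:Z * (4 * m + 2 * (k.-1)%:Z)
     + b%:Z * (2 * m' + (k.-1)%:Z)) = 1).
    by rewrite -expfzDr //; congr (_ ^ _); case: (b) => /=; lia.
  by rewrite expfzDr // ![_ * (_ + _)]mulrC -!exprz_exp !expz_mod_order // !exp1rz mulr1.
exists psi; split=> // _ /GE[i [b ->]].
by apply: translation_symmetryM; rewrite ?groupX //; apply: translation_symmetryX.
Qed.

End Labellings.

Lemma exists_cyclic_group n : (0 < n)%N ->
  exists (gT : finGroupType) (G : {group gT}), #|G| = n /\ cyclic G.
Proof.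
case: n => // n _; exists 'I_n.+1, [set: 'I_n.+1]%G; split.
  by rewrite cardsT card_ord.
by apply/cyclicP; exists Zp1; apply: Zp_cycle.
Qed.

Lemma exists_dihedral_group n : (2 < n)%N -> ~~ odd n ->
  exists (gT : finGroupType) (G : {group gT}), #|G| = n /\ is_dihedral G.
Proof.
move=> n_gt2 /even_halfK; set m := n./2 => nE.
have m_gt1 : (1 < m)%N by rewrite -ltn_double nE.
exists 'D_n, [set: 'D_n]%G; rewrite -nE; split; first exact: card_dihedral.
exists m => [|rT H]; first exact: ltnW.
by rewrite conj_presentation_dihedral; apply: Grp_dihedral.
Qed.

(** * Left group codes and the two conditions *)

Section LeftGroupCauchyCodes.
Variables (F : finFieldType) (xi : F) (n k : nat) (L : {set pline F}).
Variables (f : pline F -> F) (C : {vspace 'rV[F]_n}).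
Hypotheses (prim_xi : (#|F|.-1).-primitive_root xi) (f0 : {in L, forall z, f z != 0}).
Hypotheses (codeC : is_cauchy_code k L f C).
Hypotheses (k_ge2 : (2 <= k)%N) (k_le : (k <= #|F| - 3)%N).
Variables (gT : finGroupType) (G : {group gT}).
Implicit Type T : {'GL_2[F]}.

Lemma left_G_code_cond T : sends_to_pstar L T -> left_G_code G C ->
  (cyclic G /\ cond1 k f T) \/ (is_dihedral G /\ cond2 xi k f T).
Proof.
move=> TL; have [nE _ g0 [beta [inj_beta beta0 memC]]] := cauchy_codeP f0 TL codeC.
case/(left_G_code_labellingP _ nE inj_beta beta0 memC) => oG [psi psiG].
have trans := symmetric_labelling_translations k_ge2 k_le g0 oG psiG.
suff: {in G, forall h, exists a, scales (transport k f T) G psi h a} \/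
    exists2 t, t \in G & exists e, inverts k (transport k f T) G psi t e.
  case=> [scG | [t Gt [e te]]]; [left | right].
    exact: (scaling_labelling_cyclic prim_xi g0 oG psiG).
  exact: (inverting_labelling_dihedral k_ge2 k_le prim_xi g0 oG psiG Gt te).
(* Neither property is boolean, so the choice between all translations scaling and some translation
   inverting is made by induction along [enum G]. *)
suff: {in enum G, forall h, exists a, scales (transport k f T) G psi h a} \/
    exists2 t, t \in G & exists e, inverts k (transport k f T) G psi t e.
  by case=> [scG|]; [left=> h Gh; apply: scG; rewrite mem_enum | right].
have: {subset enum G <= G} by move=> x; rewrite mem_enum.
elim: (enum G) => [|x s IHs] sG; first by left.
have [y ys|scs|] := IHs; [by apply: sG; rewrite inE ys orbT | | by right].
have Gx : x \in G by rewrite sG ?mem_head.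
have [a [sa|ia]] := trans x Gx; last by right; exists x => //; exists a.
by left=> y; rewrite inE => /predU1P[-> | /scs //]; exists a.
Qed.

Lemma cond_left_G_code T : sends_to_pstar L T -> #|G| = #|F|.-1 ->
  (cyclic G /\ cond1 k f T) \/ (is_dihedral G /\ cond2 xi k f T) ->
  left_G_code G C.
Proof.
move=> TL oG cond; have [nE _ g0 [beta [inj_beta beta0 memC]]] := cauchy_codeP f0 TL codeC.
apply/(left_G_code_labellingP _ nE inj_beta beta0 memC); split=> //.
case: cond => [[cG c1] | [dG c2]].
  exact: (cyclic_symmetric_labelling k_ge2 k_le prim_xi g0 oG cG c1).
exact: (dihedral_symmetric_labelling k_ge2 k_le prim_xi g0 oG dG c2).
Qed.

End LeftGroupCauchyCodes.

Theorem theorem4p7 (F : finFieldType) (q : nat) (xi : F) (n k : nat)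
    (L : {set pline F}) (f : pline F -> F) (C : {vspace 'rV[F]_n}) :
  #|F| = q ->
  (q.-1).-primitive_root xi ->
  {in L, forall z, f z != 0} ->
  is_cauchy_code k L f C ->
  #|L| = q.-1 ->
  (2 <= k <= q - 3)%N ->
  let on_some (cond : {'GL_2[F]} -> Prop) :=
    exists T, sends_to_pstar L T /\ cond T in
  let on_all (cond : {'GL_2[F]} -> Prop) :=
    forall T, sends_to_pstar L T -> cond T in
  let c1 := cond1 k f in
  let c2 := cond2 xi k f in
  let c12 := fun T => c1 T \/ c2 T in
  [/\ left_group_code C <-> on_some c12,
      left_group_code C <-> on_all c12,
      on_some c1 <-> on_all c1,
      on_some c2 <-> on_all c2 &
      forall (gT : finGroupType) (G : {group gT}), #|G| = q.-1 ->
        left_G_code G C <->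
        (cyclic G /\ on_some c1) \/ (is_dihedral G /\ on_some c2)].
Proof.
move=> <- prim_xi f0 codeC oL /andP[k_ge2 k_le] on_some on_all c1 c2 c12.
have N3 := card_units_gt3 k_ge2 k_le.
have [T0 T0L] := exists_sends_to_pstar oL.
have code_cond := left_G_code_cond prim_xi f0 codeC k_ge2 k_le.
have cond_code := cond_left_G_code prim_xi f0 codeC k_ge2 k_le.
have card_code gT (G : {group gT}) : left_G_code G C -> #|G| = #|F|.-1.
  by have [<- _ _ _] := cauchy_codeP f0 T0L codeC; case.
have c1_code T : sends_to_pstar L T -> c1 T ->
    exists (gT : finGroupType) (G : {group gT}), cyclic G /\ left_G_code G C.
  move=> TL c1T; have [gT [G [oG cG]]] := exists_cyclic_group (ltn_trans (ltn0Sn _) N3).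
  by exists gT, G; split=> //; apply: (cond_code _ _ T) => //; left.
have c2_code T : sends_to_pstar L T -> c2 T ->
    exists (gT : finGroupType) (G : {group gT}), is_dihedral G /\ left_G_code G C.
  move=> TL c2T; have [oddF _] := c2T.
  have evenN : ~~ odd #|F|.-1.
    by move: oddF; rewrite -(prednK (ltnW (finNzRing_gt1 F))) /=.
  have [gT [G [oG dG]]] := exists_dihedral_group (ltnW N3) evenN.
  by exists gT, G; split=> //; apply: (cond_code _ _ T) => //; right.
have excl gT (G : {group gT}) : left_G_code G C -> cyclic G -> ~ is_dihedral G.
  by move=> /card_code oG; apply: cyclic_not_dihedral; rewrite oG ltnW.
(* Being a left code does not involve the homography: the group obtained from [T] is used again at
   [T'], where [excl] rules out the other condition. *)
have some_all1 : on_some c1 <-> on_all c1.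
  split=> [[T [TL c1T]] T' T'L|]; last by exists T0; split; auto.
  have [gT [G [cG codeG]]] := c1_code T TL c1T.
  have [[] // | [dG _]] := code_cond _ _ T' T'L codeG.
  by case: (excl _ _ codeG cG dG).
have some_all2 : on_some c2 <-> on_all c2.
  split=> [[T [TL c2T]] T' T'L|]; last by exists T0; split; auto.
  have [gT [G [dG codeG]]] := c2_code T TL c2T.
  have [[cG _] | [] //] := code_cond _ _ T' T'L codeG.
  by case: (excl _ _ codeG cG dG).
have some_code : on_some c12 -> left_group_code C.
  case=> T [TL [/(c1_code T TL) | /(c2_code T TL)]] [gT [G [_ codeG]]];
    by exists gT, G.
have code_all : left_group_code C -> on_all c12.
  case=> gT [G codeG] T TL.
  by have [[_ c1T] | [_ c2T]] := code_cond _ _ T TL codeG; [left | right].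
split=> //; try by split=> // h; apply: some_code; exists T0; split; auto.
  by split=> // h; exists T0; split; auto; apply: code_all.
move=> gT G oG; split=> [codeG | cond].
  have [[cG c1T] | [dG c2T]] := code_cond _ _ T0 T0L codeG; [left | right];
    by split=> //; exists T0.
apply: (cond_code _ _ T0) => //.
case: cond => [[cG /some_all1 c1T] | [dG /some_all2 c2T]]; [left | right];
  by split=> //; first [exact: c1T | exact: c2T].
Qed.
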